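(* Let $H\in\mathcal N_2$ be a normal affine semigroup in $\mathbb N^2$ with extremal rays $\mathbf a_1,\mathbf a_2$, and let $\mathbf b$ be the bottom element of $H$. The following conditions are equivalent: (a) $\mathbf b$ is an Ulrich element in $H$; (b) for $i=1,2$, if $\mathbf p,\mathbf q\in H_i^*$ then $\mathbf p+\mathbf q\notin H_i^*$.
   Context: $\mathbb N=\{0,1,2,\dots\}$. $\mathcal N_2$ is the class of normal affine semigroups $H\subseteq\mathbb N^2$ generating $\mathbb Z^2$ as a group: $H$ is a finitely generated submonoid of $\mathbb N^2$ with $H=C\cap\mathbb Z^2$, where $C\subseteq\mathbb R^2$ is the (two-dimensional) cone generated by $H$. The extremal rays of $H$ are the primitive lattice vectors $\mathbf a_1,\mathbf a_2\in H$ lying on the two extremal rays of $C$. Put $\omega_H=\mathbb Z^2\cap\operatorname{relint}C$. The bottom element $\mathbf b$ of $H$ is the unique element of $\omega_H$ that is minimal (least) in $\omega_H$ for the componentwise order on $\mathbb N^2$ (it always exists). For $i=1,2$, $H_i^*=\mathbb Z^2\cap\{r_1\mathbf a_i+r_2\mathbf b:0<r_1,r_2<1\}$. Let $K$ be a field. $R=K[H]$ is the subalgebra of the polynomial ring in two variables over $K$ spanned by the monomials $\mathbf x^{\mathbf h}$, $\mathbf h\in H$; its graded maximal ideal $\mathfrak m$ is generated by $\mathbf x^{\mathbf h}$, $0\ne\mathbf h\in H$. The canonical module $\omega_R$ is the ideal of $R$ spanned over $K$ by the monomials $\mathbf x^{\mathbf h}$, $\mathbf h\in\omega_H$. A graded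 Cohen–Macaulay $R$-module $E$ is Ulrich if its minimal number of generators equals its multiplicity $e(E)$ with respect to $\mathfrak m$; the zero module counts as Ulrich. An element $\mathbf c\in\omega_H$ is called an Ulrich element in $H$ if $\omega_R/\mathbf x^{\mathbf c}R$ is an Ulrich $R$-module. *)

(* Defs.v *)
From HB Require Import structures.
From mathcomp Require Import all_boot all_order all_algebra.
From mathcomp Require Import boolp classical_sets reals.
From mathcomp Require Import generic_quotient ring_quotient mpoly.

Set Implicit Arguments.
Unset Strict Implicit.
Unset Printing Implicit Defensive.

Import Order.TTheory GRing.Theory Num.Theory.

Local Open Scope classical_set_scope.
Local Open Scope ring_scope.
Local Open Scope quotient_scope.

Section Chains.
Variable T : Type.

Definition strict_chain (Q : set (set T)) (F : nat -> set T) (d : nat) : Prop :=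
  (forall i, (i <= d)%N -> Q (F i)) /\
  (forall i, (i < d)%N -> F i `<` F i.+1).

(* [d] is the supremum of the lengths of the finite chains
   F 0 < F 1 < ... < F d in [Q] (and this supremum is finite). *)
Definition max_chain_length (Q : set (set T)) (d : nat) : Prop :=
  (exists F, strict_chain Q F d) /\
  (forall F k, strict_chain Q F k -> (k <= d)%N).

End Chains.

Section ModuleNotions.
Variables (R : comNzRingType) (E : lmodType R).

Definition submodule (N : set E) : Prop :=
  N 0 /\ forall (a : R) (x y : E), N x -> N y -> N (a *: x + y).

Definition span (A : set E) : set E :=
  [set x | exists s : seq (R * E),
     (forall p, p \in s -> A p.2) /\ x = \sum_(p <- s) p.1 *: p.2].

Definition smul (I : set R) (N : set E) : set E :=
  span [set y | exists a x, [/\ I a, N x & y = a *: x]].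

Fixpoint smul_pow (I : set R) (n : nat) : set E :=
  if n is n'.+1 then smul I (smul_pow I n') else setT.

(* The length of E / N is n: the submodules of E / N are the submodules of E
   that contain N. *)
Definition quot_length (N : set E) (n : nat) : Prop :=
  max_chain_length [set L | submodule L /\ N `<=` L] n.

Definition annihilator : set R := [set a | forall x : E, a *: x = 0].

Definition min_generators (n : nat) : Prop :=
  (exists s : seq E, size s = n /\ span [set` s] = setT) /\
  (forall s : seq E, span [set` s] = setT -> (n <= size s)%N).

Definition regular_seq (s : seq R) : Prop :=
  (forall i, (i < size s)%N -> forall x : E,
     smul [set` take i s] setT (s`_i *: x) -> smul [set` take i s] setT x) /\
  smul [set` s] setT <> setT.

End ModuleNotions.

Arguments annihilator {R} E.
Arguments min_generators {R} E n.
Arguments regular_seq {R} E s.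
Arguments smul_pow {R} E I n.

Section Ulrich.
Variable R : comNzRingType.

Definition ideal_gen (A : set R) : set R := @span R R^o A.

Definition ideal (I : set R) : Prop := @submodule R R^o I.

Definition prime_ideal (P : set R) : Prop :=
  [/\ ideal P, ~ P 1 & forall a b, P (a * b) -> P a \/ P b].

Variables (m : set R) (E : lmodType R).

(* The dimension of E is the Krull dimension of R / Ann(E). *)
Definition krull_dim (d : nat) : Prop :=
  max_chain_length [set P | prime_ideal P /\ annihilator E `<=` P] d.

Definition depth (n : nat) : Prop :=
  (exists s : seq R,
     [/\ size s = n, (forall a, a \in s -> m a) & regular_seq E s]) /\
  (forall s : seq R,
     (forall a, a \in s -> m a) -> regular_seq E s -> (size s <= n)%N).

(* This is the notion for a nonzero finitely generated graded module over a
   positively graded K-algebra with graded maximal ideal m: the depth is the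
   grade of m on E, regular sequences not being required to be homogeneous.
   The only module it is applied to below is a quotient of two ideals spanned
   by monomials, hence graded. *)
Definition cohen_macaulay : Prop := exists d, krull_dim d /\ depth d.

(* The Hilbert-Samuel function n |-> length (E / m^(n+1) E) agrees for large n
   with a polynomial of degree d = dim E and leading coefficient e / d!. *)
Definition multiplicity (e : nat) : Prop :=
  exists d (P : {poly rat}),
    [/\ krull_dim d,
        size P = d.+1,
        lead_coef P * (d`!)%:R = e%:R
      & exists N : nat, forall n, (N <= n)%N ->
          exists l, quot_length (smul_pow E m n.+1) l /\ P.[n%:R] = l%:R].

Definition ulrich : Prop :=
  (forall x : E, x = 0) \/
  (cohen_macaulay /\ exists e, min_generators E e /\ multiplicity e).

End Ulrich.

Section QuotientModule.
Variables (R : comNzRingType) (V : lmodType R) (N : submodClosed V).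

Definition quot_pred : {pred V} := N.

Lemma quot_mod_zmod_closed : zmod_closed quot_pred.
Proof.
split=> [|x y Nx Ny]; first exact: (rpred0 N).
apply: (rpredD (S := N)) => //.
by rewrite -scaleN1r; apply: (rpredZ (s := N)).
Qed.

HB.instance Definition _ := GRing.isZmodClosed.Build V quot_pred quot_mod_zmod_closed.

Definition quot_mod := @Quotient.quot V quot_pred.

HB.instance Definition _ := GRing.Zmodule.on quot_mod.
HB.instance Definition _ := EqQuotient.on quot_mod.

Definition quot_scale (a : R) (x : quot_mod) : quot_mod :=
  \pi_quot_mod (a *: repr x).

Lemma pi_scale (a : R) (v : V) :
  quot_scale a (\pi_quot_mod v) = \pi_quot_mod (a *: v).
Proof.
have rv : repr (\pi_quot_mod v) - v \in quot_pred.
  by rewrite Quotient.idealrBE reprK.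
apply/eqP; rewrite /quot_scale -[_ == _]Quotient.idealrBE -scalerBr.
exact: (rpredZ (s := N)).
Qed.

Lemma pi_add (u v : V) : \pi_quot_mod u + \pi_quot_mod v = \pi_quot_mod (u + v).
Proof. exact: (esym (@Quotient.pi_add V quot_pred u v)). Qed.

Lemma quot_scaleA a b x : quot_scale a (quot_scale b x) = quot_scale (a * b) x.
Proof. by elim/quotW: x => v; rewrite (pi_scale b) !pi_scale scalerA. Qed.

Lemma quot_scale1 : left_id 1 quot_scale.
Proof. by elim/quotW=> v; rewrite pi_scale scale1r. Qed.

Lemma quot_scaleDr : right_distributive quot_scale +%R.
Proof.
move=> a; elim/quotW=> u; elim/quotW=> v.
by rewrite pi_add !pi_scale pi_add scalerDr.
Qed.

Lemma quot_scaleDl x : {morph quot_scale^~ x : a b / a + b}.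
Proof. by elim/quotW: x => v a b; rewrite !pi_scale pi_add scalerDl. Qed.

HB.instance Definition _ := GRing.Zmodule_isLmodule.Build R quot_mod
  quot_scaleA quot_scale1 quot_scaleDr quot_scaleDl.

End QuotientModule.

Section Cones.
Variables (F : realType) (n : nat).
Local Notation V := 'rV[F]_n.
Implicit Types A C : set V.

Definition cone A : set V :=
  [set v | exists s : seq (F * V),
     (forall p, p \in s -> 0 <= p.1 /\ A p.2) /\ v = \sum_(p <- s) p.1 *: p.2].

Definition affine_hull A : set V :=
  [set v | exists s : seq (F * V),
     [/\ forall p, p \in s -> A p.2,
         \sum_(p <- s) p.1 = 1
       & v = \sum_(p <- s) p.1 *: p.2]].

Definition relint A : set V :=
  [set x | A x /\ exists e : F, 0 < e /\
     forall y, affine_hull A y -> (forall i, `|y 0 i - x 0 i| < e) -> A y].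

Definition ray (v : V) : set V := [set w | exists r : F, 0 <= r /\ w = r *: v].

(* The ray spanned by v is a one-dimensional face of C. *)
Definition extremal_ray C (v : V) : Prop :=
  [/\ C v, v <> 0
    & forall x y, C x -> C y -> ray v (x + y) -> ray v x /\ ray v y].

End Cones.

Record submonoid := Submonoid {
  submonoid_set :> set 'X_{1..2};
  submonoid0 : submonoid_set 0%MM;
  submonoidD : forall h k,
    submonoid_set h -> submonoid_set k -> submonoid_set (h + k)%MM
}.

Section Semigroups.
Variable F : realType.

Definition toZ (h : 'X_{1..2}) : 'rV[int]_2 := \row_i (h i)%:Z.
Definition ZtoR (z : 'rV[int]_2) : 'rV[F]_2 := map_mx intr z.
Definition toR (h : 'X_{1..2}) : 'rV[F]_2 := ZtoR (toZ h).

Definition cone_of (H : set 'X_{1..2}) : set 'rV[F]_2 := cone (toR @` H).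

Definition finitely_generated (H : set 'X_{1..2}) : Prop :=
  exists s : seq 'X_{1..2}, (forall g, g \in s -> H g) /\
    forall h, H h -> exists c : 'X_{1..2} -> nat,
      h = (\sum_(g <- s) (g *+ c g))%MM.

Definition generates_Z2 (H : set 'X_{1..2}) : Prop :=
  forall G : set 'rV[int]_2,
    G 0 -> (forall x y, G x -> G y -> G (x - y)) ->
    (forall h, H h -> G (toZ h)) -> G = setT.

Definition normal (H : set 'X_{1..2}) : Prop :=
  toZ @` H = [set z | cone_of H (ZtoR z)].

Definition normal_affine (H : submonoid) : Prop :=
  [/\ finitely_generated H, generates_Z2 H & normal H].

Definition primitive (h : 'X_{1..2}) : Prop := coprime (h ord0) (h ord_max).

Definition extremal_vector (H : set 'X_{1..2}) (a : 'X_{1..2}) : Prop :=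
  [/\ H a, primitive a & extremal_ray (cone_of H) (toR a)].

(* As H is contained in N^2, so is the set of the lattice points of its cone. *)
Definition omega (H : set 'X_{1..2}) : set 'X_{1..2} :=
  [set h | relint (cone_of H) (toR h)].

Definition bottom (H : set 'X_{1..2}) (b : 'X_{1..2}) : Prop :=
  omega H b /\ forall h, omega H h -> (b <= h)%MM.

(* The set H_i^* attached to a = a_i and b; it lies in N^2 as a and b do. *)
Definition star (a b : 'X_{1..2}) : set 'X_{1..2} :=
  [set h | exists r1 r2 : F,
     [/\ 0 < r1 < 1, 0 < r2 < 1 & toR h = r1 *: toR a + r2 *: toR b]].

End Semigroups.

Arguments toR F h : clear implicits.
Arguments cone_of F H : clear implicits.
Arguments normal_affine F H : clear implicits.
Arguments extremal_vector F H a : clear implicits.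
Arguments omega F H : clear implicits.
Arguments bottom F H b : clear implicits.
Arguments star F a b : clear implicits.

Section ConeFacts.
Variables (F : realType) (H : submonoid).

Lemma toRD h k : toR F (h + k)%MM = toR F h + toR F k.
Proof. by apply/rowP=> i; rewrite !mxE mnmDE PoszD rmorphD. Qed.

Lemma cone_of_mem h : submonoid_set H h -> cone_of F H (toR F h).
Proof.
move=> Hh; exists [:: (1, toR F h)]; split; last by rewrite big_seq1 scale1r.
by move=> p; rewrite inE => /eqP -> /=; split; rewrite ?ler01 //; exists h.
Qed.

Lemma cone_ofD x y : cone_of F H x -> cone_of F H y -> cone_of F H (x + y).
Proof.
move=> [s [sP ->]] [t [tP ->]]; exists (s ++ t); split; last by rewrite big_cat.
by move=> p; rewrite mem_cat => /orP[/sP|/tP].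
Qed.

Lemma omegaD h k : submonoid_set H h -> omega F H k -> omega F H (h + k)%MM.
Proof.
move=> Hh [Ck [e [e0 kP]]]; split.
  by rewrite toRD; apply: cone_ofD => //; exact: cone_of_mem.
exists e; split=> // y [s [sA s1 ->]] yP.
set y' := \sum_(p <- s) _ in yP *.
have -> : y' = (y' - toR F h) + toR F h by rewrite subrK.
apply: cone_ofD; last exact: cone_of_mem.
apply: kP; last first.
  by move=> i; have := yP i; rewrite toRD !mxE opprD addrA.
exists [:: (-1, toR F h), (1, toR F 0%MM) & s]; split.
- move=> p; rewrite !inE => /or3P[/eqP->|/eqP->|/sA//] /=.
    exact: cone_of_mem.
  exact/cone_of_mem/submonoid0.
- by rewrite !big_cons s1 /= addrA addNr add0r.
- rewrite !big_cons /= scaleN1r scale1r.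
  have -> : toR F 0%MM = 0 by apply/rowP=> i; rewrite !mxE mnm0E.
  by rewrite add0r addrC.
Qed.

End ConeFacts.

Section SemigroupRing.
Variables (K : fieldType) (H : submonoid).

(* The K-span of the monomials with exponent in H. *)
Definition in_sring : {pred {mpoly K[2]}} :=
  fun p => `[< forall h, h \in msupp p -> submonoid_set H h >].

Lemma in_sring_subring : subring_closed in_sring.
Proof.
split=> [|p q /asboolP pH /asboolP qH|p q /asboolP pH /asboolP qH];
  apply/asboolP=> h.
- by rewrite msupp1 inE => /eqP->; exact: submonoid0.
- by move=> /msuppB_le; rewrite mem_cat => /orP[/pH|/qH].
- by move=> /msuppM_le /allpairsP[[u v] /= [/pH ? /qH ? ->]]; exact: submonoidD.
Qed.

HB.instance Definition _ :=
  GRing.isSubringClosed.Build {mpoly K[2]} in_sring in_sring_subring.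

Record sring := SRing { sring_val : {mpoly K[2]}; _ : sring_val \in in_sring }.

HB.instance Definition _ := [isSub for sring_val].
HB.instance Definition _ := [Choice of sring by <:].
HB.instance Definition _ := [SubChoice_isSubComNzRing of sring by <:].

Definition sring_max : set sring :=
  ideal_gen [set r | exists h, [/\ submonoid_set H h, h <> 0%MM & val r = 'X_[h]]].

Variable F : realType.

Definition in_canonical : {pred sring^o} :=
  fun r => `[< forall h, h \in msupp (val (r : sring)) -> omega F H h >].

Lemma in_canonical_submod : submod_closed in_canonical.
Proof.
split; first by apply/asboolP=> h; rewrite rmorph0 msupp0.
move=> a u v /asboolP uP /asboolP vP; apply/asboolP=> h.
rewrite rmorphD => /msuppD_le; rewrite mem_cat => /orP[|/vP//].
rewrite rmorphM => /msuppM_le /allpairsP[[k l] /= [ka /uP ? ->]].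
by apply: omegaD => //; case: a ka => a /= /asboolP; apply.
Qed.

HB.instance Definition _ :=
  GRing.isSubmodClosed.Build sring sring^o in_canonical in_canonical_submod.

Record canonical_mod :=
  CanonicalMod { canonical_val : sring^o; _ : canonical_val \in in_canonical }.

HB.instance Definition _ := [isSub for canonical_val].
HB.instance Definition _ := [Choice of canonical_mod by <:].
HB.instance Definition _ := [SubChoice_isSubLmodule of canonical_mod by <:].

(* The submodule x^c K[H] of the canonical module, for c in omega_H. *)
Definition in_principal (c : 'X_{1..2}) : {pred canonical_mod} :=
  fun w => `[< exists r : sring,
    sring_val (canonical_val w) = 'X_[c] * sring_val r >].

Lemma in_principal_submod c : submod_closed (in_principal c).
Proof.
split; first by apply/asboolP; exists 0; rewrite /= mulr0.
move=> a u v /asboolP[r ur] /asboolP[s vs]; apply/asboolP; exists (a * r + s).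
by rewrite /= ur vs mulrDr mulrCA.
Qed.

HB.instance Definition _ c :=
  GRing.isSubmodClosed.Build sring canonical_mod (in_principal c)
    (in_principal_submod c).

Definition canonical_quot (c : 'X_{1..2}) : lmodType sring :=
  quot_mod (in_principal c : submodClosed canonical_mod).

Definition ulrich_element (c : 'X_{1..2}) : Prop :=
  omega F H c /\ ulrich sring_max (canonical_quot c).

End SemigroupRing.

(* Main.v *)
Require Import Defs.
From mathcomp Require Import all_boot all_order all_algebra.
From mathcomp Require Import boolp classical_sets reals.
From mathcomp Require Import generic_quotient ring_quotient mpoly.
From mathcomp Require Import ring lra zify.
Import Defs.

(** Let [l i] be the linear form vanishing on the extremal vector [a i] and
    positive inside the cone. As the bottom element [b] lies below every interior
    point, [omega_R / x^b R] has as a [K]-basis the monomials of the two disjoint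
    strips [S_i = {u in omega_H | l i u < l i b}], the product of [x^h] with [x^u]
    being [x^(h + u)] or [0] according to whether [h + u] is in a strip. Each
    [u] in [S_i] is uniquely [p + n a_i] with [p] in [G_i = H_i^*].

    Since a product of many elements of [H] which stays in [S_i] consists of
    multiples of [a i] up to a bounded number of factors, the length of
    [E / m^(n+1) E] differs from [(|G_1| + |G_2|) n] by a bounded amount, so that
    the multiplicity is [|G_1| + |G_2|]. The generators [x^p], [p] in
    [G_1] or [G_2], are as many, and form a minimal system exactly when no sum of
    two elements of [G_i] is in [G_i]. *)

Set Implicit Arguments.
Unset Strict Implicit.
Unset Printing Implicit Defensive.

Import Order.TTheory GRing.Theory Num.Theory.

Local Open Scope classical_set_scope.
Local Open Scope ring_scope.

(** * Submodules, lengths and polynomials of linear growth *)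

(** The two implications need different control of [m^n E]. If no [G_i] contains a sum of two of its
    elements, every monomial factor other than 1 raises the multiple of [a_i], and [m^n E] is
    exactly the span of the exponents with multiple at least [n]. When this is what must be proved,
    a factor may merely move [p] inside the finite set [G_i]; only a sandwich for [m^n E] is then
    available, in which the bounded value [l i p] counts the wasted factors. When [E] is nonzero it
    is Cohen-Macaulay of dimension 1, whether or not the sums are excluded: on the strip [S_i] the
    monomial of [a_i] acts injectively and that of the other ray by zero, so the sum of the two is
    regular; and modulo the ideal of the face of [a_i] the ring becomes [K[X]], which bounds the
    dimension and the depth. *)

Section Submodules.
Variables (R : comNzRingType) (E : lmodType R).
Implicit Types (L N : set E) (A : set E) (s : seq E).

Lemma submoduleZ L a x : submodule L -> L x -> L (a *: x).
Proof. by move=> [L0 LP] Lx; rewrite -[_ *: _]addr0; apply: LP. Qed.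

Lemma submoduleD L x y : submodule L -> L x -> L y -> L (x + y).
Proof. by move=> [L0 LP] Lx Ly; rewrite -[x]scale1r; apply: LP. Qed.

Lemma submodule_sum L (I : eqType) (r : seq I) (F : I -> E) :
  submodule L -> (forall i, i \in r -> L (F i)) -> L (\sum_(i <- r) F i).
Proof.
move=> sL; elim: r => [|i r IH] FL; first by rewrite big_nil; case: sL.
rewrite big_cons; apply: submoduleD => //; first by apply: FL; rewrite inE eqxx.
by apply: IH => j jr; apply: FL; rewrite inE jr orbT.
Qed.

Lemma submoduleB L x y : submodule L -> L x -> L y -> L (x - y).
Proof.
by move=> sL Lx Ly; apply: submoduleD => //; rewrite -scaleN1r; apply: submoduleZ.
Qed.

Lemma submodule_set1 : submodule [set (0 : E)].
Proof. by split=> // a x y /= -> ->; rewrite scaler0 addr0. Qed.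

Lemma span_submodule A : submodule (span A).
Proof.
split; first by exists [::]; rewrite big_nil.
move=> a x y [s [sA ->]] [t [tA ->]].
exists ([seq (a * p.1, p.2) | p <- s] ++ t); split.
  by move=> p; rewrite mem_cat => /orP[/mapP[q qs ->]|/tA//]; exact: (sA _ qs).
rewrite big_cat big_map scaler_sumr; congr (_ + _).
by apply: eq_bigr => p _; rewrite scalerA.
Qed.

Lemma subset_span_gen A : A `<=` span A.
Proof.
move=> x Ax; exists [:: (1, x)]; split; last by rewrite big_seq1 scale1r.
by move=> p; rewrite inE => /eqP ->.
Qed.

Lemma span_min A L : submodule L -> A `<=` L -> span A `<=` L.
Proof.
move=> sL AL x [s [sA ->]]; apply: submodule_sum => // p ps.
by apply: submoduleZ => //; apply/AL/sA.
Qed.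

Lemma smul_min (I : set R) N L : submodule L ->
  (forall a x, I a -> N x -> L (a *: x)) -> smul I N `<=` L.
Proof. by move=> sL LP; apply: span_min => // y [a [x [Ia Nx ->]]]; apply: LP. Qed.

Lemma smulI (I : set R) N a x : I a -> N x -> smul I N (a *: x).
Proof. by move=> Ia Nx; apply: subset_span_gen; exists a, x. Qed.

Lemma smul_pow_submodule (I : set R) n : submodule (smul_pow E I n).
Proof. by case: n => [|n] //=; exact: span_submodule. Qed.

Lemma smul0 : smul [set` [::]] setT = [set (0 : E)].
Proof.
apply/seteqP; split; first by apply: smul_min => //; exact: submodule_set1.
by move=> x ->; case: (span_submodule [set y : E | exists (a : R) (x : E),
   [/\ [set` [::]] a, setT x & y = a *: x]]).
Qed.

Lemma smul1 a : smul [set` [:: a]] setT = [set x : E | exists y, x = a *: y].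
Proof.
apply/seteqP; split; last first.
  by move=> x [y ->]; apply: smulI => //=; rewrite inE eqxx.
apply: smul_min.
  split; first by exists 0; rewrite scaler0.
  move=> c x y [x' ->] [y' ->]; exists (c *: x' + y').
  by rewrite scalerDr !scalerA mulrC.
by move=> c x /=; rewrite inE => /eqP -> _; exists x.
Qed.

Lemma quot_length_mono N N' l l' : N `<=` N' ->
  quot_length N l -> quot_length N' l' -> (l' <= l)%N.
Proof.
move=> NN' [_ max] [[F [FQ Flt]] _]; apply: (max F); split=> // i il.
by have [sF NF] := FQ i il; split=> //; exact: subset_trans NF.
Qed.

End Submodules.

Lemma poly_nat_roots_eq0 (p : {poly rat}) N :
  (forall n, (N <= n)%N -> p.[n%:R] = 0) -> p = 0.
Proof.
move=> p0; apply/eqP; apply: contraT => pn0.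
have := @max_poly_roots _ p [seq ((N + i)%N)%:R | i <- iota 0 (size p)] pn0.
rewrite size_map size_iota ltnn => -> //.
  by apply/allP => x /mapP[i _ ->]; apply/eqP/p0; lia.
rewrite map_inj_uniq ?iota_uniq // => i j /eqP.
by rewrite eqr_nat eqn_add2l => /eqP.
Qed.

(* [P - (e X + e - k)] vanishes at [n] for some [k <= e c] depending on [n], so
   the product of these polynomials over [k] has infinitely many roots. *)
Lemma poly_of_linear_growth (P : {poly rat}) (e c N : nat) :
  (forall n, (N <= n)%N -> exists l : nat,
     P.[n%:R] = l%:R /\ (e * (n.+1 - c) <= l <= e * n.+1)%N) ->
  exists k : rat, P = e%:R *: 'X + k%:P.
Proof.
move=> PP.
pose f (k : nat) : {poly rat} := P - (e%:R *: 'X + (e%:R - k%:R)%:P).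
have : \prod_(k < (e * c).+1) f k = 0.
  apply: (@poly_nat_roots_eq0 _ N) => n Nn.
  have [l [Pl /andP[l1 l2]]] := PP n Nn.
  have kP : (e * n.+1 - l < (e * c).+1)%N.
    rewrite ltnS leq_subLR addnC -leq_subLR.
    by apply: leq_trans l1; rewrite mulnBr; lia.
  rewrite (bigD1 (Ordinal kP)) //= hornerM [X in X * _](_ : _ = 0) ?mul0r //.
  rewrite /f !hornerE Pl /= natrB // natrM -natr1; ring.
move/eqP/prodf_eq0 => [k _]; rewrite subr_eq0 => /eqP ->.
by exists (e%:R - k%:R).
Qed.

(** * The two strips along the extremal rays *)

(** All that the combinatorics needs from the cone; the real field enters through the instance
    [two_facets_form]. The rays are indexed by [bool], so that [~~ i] is the other one. The field
    [facet_le] reflects that a lattice vector of the cone has nonnegative coordinates. *)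
Record two_facets (H om : set 'X_{1..2}) (a : bool -> 'X_{1..2}) (b : 'X_{1..2})
    (l : bool -> 'X_{1..2} -> int) : Prop := TwoFacets {
  facetD : forall i h k, l i (h + k)%MM = l i h + l i k;
  facet_le : forall h k, (forall i, l i k <= l i h) -> (k <= h)%MM;
  facet_mem : forall h, H h <-> forall i, 0 <= l i h;
  facet_int : forall h, om h <-> forall i, 0 < l i h;
  facet_ray : forall i, l i (a i) = 0;
  facet_rayN : forall i, 0 < l i (a (~~ i));
  facet_face : forall i h, H h -> l i h = 0 -> exists j, h = (a i *+ j)%MM;
  facet_bot : om b;
  facet_bot_le : forall h, om h -> (b <= h)%MM
}.

Lemma neq_negb (i j : bool) : j != i -> j = ~~ i.
Proof. by case: i; case: j. Qed.

Section Strips.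
Variables (H om : set 'X_{1..2}) (a : bool -> 'X_{1..2}) (b : 'X_{1..2}).
Variables (l : bool -> 'X_{1..2} -> int).
Hypothesis D : two_facets H om a b l.
Implicit Types (h k p q u : 'X_{1..2}) (i : bool).

Lemma facet0 i : l i 0%MM = 0.
Proof. by have := facetD D i 0%MM 0%MM; rewrite addm0; lia. Qed.

Lemma facetMn i h n : l i (h *+ n)%MM = l i h * n%:Z.
Proof.
elim: n => [|n IH]; first by rewrite mulm0n facet0 mulr0.
by rewrite mulmS (facetD D) IH; lia.
Qed.

Lemma facet_rayMn i n : l i (a i *+ n)%MM = 0.
Proof. by rewrite facetMn (facet_ray D) mul0r. Qed.

Lemma int_mem h : om h -> H h.
Proof. by rewrite (facet_int D) (facet_mem D) => hP i; apply: ltW. Qed.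

Lemma facet_ge0 i h : H h -> 0 <= l i h.
Proof. by rewrite (facet_mem D). Qed.

Lemma facet_gt0 i h : om h -> 0 < l i h.
Proof. by rewrite (facet_int D). Qed.

Lemma intDl h k : H h -> om k -> om (h + k)%MM.
Proof.
move=> Hh ok; apply/(facet_int D) => i; rewrite (facetD D).
by have := facet_ge0 i Hh; have := facet_gt0 i ok; lia.
Qed.

Lemma ray_mem i : H (a i).
Proof.
apply/(facet_mem D) => j; have [->|ji] := eqVneq j i; first by rewrite (facet_ray D).
by rewrite -[i]negbK -(neq_negb ji); exact/ltW/(facet_rayN D).
Qed.

Lemma rayMn_mem i n : H (a i *+ n)%MM.
Proof.
by apply/(facet_mem D) => j; rewrite facetMn; have := facet_ge0 j (ray_mem i); nia.
Qed.

Lemma ray_neq0 i : a i <> 0%MM.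
Proof. by move=> ai; have := facet_rayN D (~~ i); rewrite negbK ai facet0. Qed.

Lemma mem_diff h k : (forall i, l i k <= l i h) -> exists2 u, H u & h = (u + k)%MM.
Proof.
move=> kh; have le_kh := facet_le D kh.
exists (h - k)%MM; last by rewrite submK.
apply/(facet_mem D) => i; have := kh i.
by rewrite -{1}(submK le_kh) (facetD D); lia.
Qed.

Lemma int_diff h k : (forall i, l i k < l i h) -> exists2 u, om u & h = (u + k)%MM.
Proof.
move=> kh; have [|u _ hE] := @mem_diff h k; first by move=> i; apply: ltW.
exists u => //; apply/(facet_int D) => i; have := kh i.
by rewrite hE (facetD D); lia.
Qed.

(** Otherwise [b - h] would be interior, hence at least [b], which forces [h = 0]. This makes the
    two strips disjoint. *)
Lemma int_not_lt_bot h : om h -> ~ (forall i, l i h < l i b).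
Proof.
move=> oh lt_hb; have [u ou bE] := int_diff lt_hb.
have /mnm_lepP le_bh := facet_bot_le D oh.
have /mnm_lepP le_bu := facet_bot_le D ou.
have h0 : h = 0%MM.
  apply/mnmP => i; have := le_bu i; rewrite bE mnmDE mnm0E; lia.
by have := facet_gt0 true oh; rewrite h0 facet0.
Qed.

(** Otherwise [b - a (~~ i)] would be an interior point, and [b] would not be least. *)
Lemma facet_bot_le_ray i : l i b <= l i (a (~~ i)).
Proof.
rewrite leNgt; apply/negP => lt_ab.
have [j|u ou bE] := @int_diff b (a (~~ i)).
  have [->//|ji] := eqVneq j i.
  by rewrite (neq_negb ji) (facet_ray D); apply/facet_gt0/(facet_bot D).
have /mnm_lepP le_bu := facet_bot_le D ou.
apply: (@ray_neq0 (~~ i)); apply/mnmP => j.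
by have := le_bu j; rewrite bE mnmDE mnm0E; lia.
Qed.

Definition strip i : set 'X_{1..2} := [set u | om u /\ l i u < l i b].

Definition strips : set 'X_{1..2} := [set u | exists i, strip i u].

(** A description of [H_i^*] without real coefficients; [starP] identifies the two. *)
Definition strip_gen i : set 'X_{1..2} :=
  [set p | strip i p /\ ~ exists2 u, om u & p = (u + a i)%MM].

Lemma strip_inj i j u : strip i u -> strip j u -> i = j.
Proof.
move=> [ou ui] [_ uj]; have [//|ij] := eqVneq i j.
case: (int_not_lt_bot ou) => k.
have [->//|kj] := eqVneq k j; rewrite (neq_negb kj).
by have -> : ~~ j = i by rewrite -(neq_negb ij).
Qed.

Lemma strips_int u : strips u -> om u.
Proof. by case=> i []. Qed.

Lemma not_strips u : om u -> ~ strips u -> exists2 k, H k & u = (k + b)%MM.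
Proof.
move=> ou nu; apply: mem_diff => i; rewrite leNgt; apply/negP => ub.
by apply: nu; exists i.
Qed.

Lemma bot_notin_strips k : H k -> ~ strips (k + b)%MM.
Proof. by move=> Hk [i [_]]; rewrite (facetD D); have := facet_ge0 i Hk; lia. Qed.

Lemma strip_sub i h u : H h -> om u -> strip i (h + u)%MM -> strip i u.
Proof.
move=> Hh ou [_]; rewrite (facetD D) => ub; split=> //.
by have := facet_ge0 i Hh; lia.
Qed.

Lemma strip_face i h u : H h -> l i h = 0 -> strip i u -> strip i (h + u)%MM.
Proof.
by move=> Hh lh [ou ub]; split; [exact: intDl|rewrite (facetD D) lh add0r].
Qed.

Lemma strip_addray i u n : strip i u -> strip i (u + a i *+ n)%MM.
Proof.
move=> iu; rewrite addmC; apply: strip_face iu; last exact: facet_rayMn.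
exact: rayMn_mem.
Qed.

(** For [j] other than [i], adding [a j] raises [l i] by at least [l i b]. Thus the monomial of one
    ray annihilates the strip of the other. *)
Lemma strip_shift i j v : strip i (a j + v)%MM -> om v -> i = j.
Proof.
move=> ajv ov; apply: contrapT => /nesym/eqP ij.
case: ajv => _; rewrite (facetD D) (neq_negb ij).
by have := facet_bot_le_ray i; have := facet_gt0 i ov; lia.
Qed.

Lemma strip_decomp i u : strip i u ->
  exists p n, strip_gen i p /\ u = (p + a i *+ n)%MM.
Proof.
have [d] := ubnP (mdeg u); elim: d u => // d IH u ud iu.
have [[v ov uE]|nu] := pselect (exists2 v, om v & u = (v + a i)%MM).
  have mda : (0 < mdeg (a i))%N.
    by rewrite lt0n mdeg_eq0; apply/eqP/ray_neq0.
  have [||p [n [pG vE]]] := IH v; first by move: ud; rewrite uE mdegD; lia.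
    by split=> //; move: iu => [_]; rewrite uE (facetD D) (facet_ray D) addr0.
  by exists p, n.+1; split=> //; rewrite uE vE mulmSr addmA.
by exists u, 0%N; rewrite mulm0n addm0.
Qed.

Lemma strip_gen_eq0 i p n q : strip_gen i p -> strip i q ->
  p = (q + a i *+ n)%MM -> n = 0%N.
Proof.
move=> [_ pN] iq; case: n => // n pE; case: pN.
exists (q + a i *+ n)%MM; last by rewrite pE mulmSr addmA.
by case: (strip_addray n iq).
Qed.

Lemma strip_decomp_inj i j p q n m : strip_gen i p -> strip_gen j q ->
  (p + a i *+ n = q + a j *+ m)%MM -> [/\ i = j, p = q & n = m].
Proof.
move=> pG qG pq; have ij : i = j.
  by apply: (@strip_inj i j (p + a i *+ n)%MM);
    [|rewrite pq]; apply: strip_addray; [case: pG|case: qG].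
case: _ / ij in qG pq *.
have MnD (k k' : nat) : (a i *+ (k + k') = a i *+ k + a i *+ k')%MM.
  by apply/mnmP => x; rewrite mnmDE !mulmnE mulnDr.
wlog nm : n m p q pG qG pq / (n <= m)%N.
  move=> WH; case/orP: (leq_total n m) => nm; first exact: (WH n m p q).
  by have [] := WH m n q p qG pG (esym pq) nm.
have pE : p = (q + a i *+ (m - n))%MM.
  by apply: (@addIm _ (a i *+ n)%MM); rewrite pq -addmA -MnD subnK.
have mn0 := strip_gen_eq0 pG (proj1 qG) pE.
have -> : n = m by lia.
by split=> //; rewrite pE mn0 mulm0n addm0.
Qed.

(** If [p] exceeded [a i + b] in the other form, [p - a i] would still be interior. The bound makes
    [strip_gens] a finite enumeration. *)
Lemma strip_gen_le i p : strip_gen i p -> (p <= a i + b)%MM.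
Proof.
move=> [[op pb] pN]; apply: (facet_le D) => j; rewrite (facetD D).
have [->|ji] := eqVneq j i; first by rewrite (facet_ray D); lia.
rewrite leNgt; apply/negP => lt_p; case: pN; apply: int_diff => k.
have [->|ki] := eqVneq k i; first by rewrite (facet_ray D) facet_gt0.
rewrite (neq_negb ki) -(neq_negb ji).
by have := facet_gt0 j (facet_bot D); lia.
Qed.

Definition strip_gens i : seq 'X_{1..2} :=
  [seq val m | m : 'X_{1..2 < (mdeg (a i + b)%MM).+1} <- enum predT
             & `[< strip_gen i (val m) >]].

Lemma strip_gensP i p : reflect (strip_gen i p) (p \in strip_gens i).
Proof.
apply: (iffP mapP) => [[m]|pG].
  by rewrite mem_filter => /andP[/asboolP mG _] ->.
have pd : (mdeg p < (mdeg (a i + b)%MM).+1)%N.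
  by rewrite ltnS; apply/lemc_mdeg/lem_leo/strip_gen_le.
by exists (BMultinom pd) => //; rewrite mem_filter mem_enum andbT; apply/asboolP.
Qed.

Lemma strip_gens_uniq i : uniq (strip_gens i).
Proof.
rewrite map_inj_uniq => [|x y]; last exact: val_inj.
exact/filter_uniq/enum_uniq.
Qed.

Definition gens : seq 'X_{1..2} := strip_gens true ++ strip_gens false.

Lemma gensP p : reflect (exists i, strip_gen i p) (p \in gens).
Proof.
rewrite mem_cat; apply: (iffP orP) => [[/strip_gensP|/strip_gensP]|[[] /strip_gensP ->]].
- by exists true.
- by exists false.
- by left.
- by right.
Qed.

Lemma gens_uniq : uniq gens.
Proof.
rewrite cat_uniq !strip_gens_uniq andbT; apply/hasPn => p /strip_gensP[pf _].
by apply/negP => /strip_gensP[pt _]; have := strip_inj pf pt.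
Qed.

(** These exponents span a submodule of [m^n E], and all of it in the sum-free case. *)
Definition level n : set 'X_{1..2} :=
  [set u | exists i p m, [/\ strip_gen i p, u = (p + a i *+ m)%MM & (n <= m)%N]].

Lemma level0 u : strips u -> level 0 u.
Proof. by case=> i /strip_decomp[p [m [pG uE]]]; exists i, p, m. Qed.

Lemma level_strips n u : level n u -> strips u.
Proof. by case=> i [p [m [[pS _] -> _]]]; exists i; apply: strip_addray. Qed.

Lemma levelS n u : level n.+1 u ->
  exists i v, [/\ level n v, strips v & u = (a i + v)%MM].
Proof.
case=> i [p [[|m] [pG -> nm]]] //; exists i, (p + a i *+ m)%MM.
split; first by exists i, p, m.
  by exists i; apply: strip_addray; case: pG.
by rewrite mulmS Monoid.mulmCA.
Qed.

(** Multiples of [a i] do not affect [l i], so [h + p] already lies in the strip; its decomposition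
    provides [q] and [m']. The last equation says that a factor off the ray raises the form on the
    generator. *)
Lemma level_shift i p m h : H h -> strip_gen i p -> strips (h + (p + a i *+ m))%MM ->
  exists q m', [/\ strip_gen i q, (h + p = q + a i *+ m')%MM,
    (h + (p + a i *+ m) = q + a i *+ (m' + m))%MM & l i h + l i p = l i q].
Proof.
move=> Hh pG [j jS].
have ij : i = j.
  apply: (@strip_inj i j (p + a i *+ m)%MM); first by apply: strip_addray; case: pG.
  by apply: strip_sub jS => //; case: (strip_addray m (proj1 pG)).
case: _ / ij in jS *.
have : strip i (h + p)%MM.
  case: pG => [[op _] _]; split; first exact: intDl.
  by case: jS => _; rewrite !(facetD D) facet_rayMn addr0.
case/strip_decomp => q [m' [qG hpE]]; exists q, m'; split=> //.
  rewrite addmA hpE; apply/mnmP => x.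
  by rewrite !mnmDE !mulmnE; lia.
by rewrite -(facetD D) hpE (facetD D) facet_rayMn addr0.
Qed.

Lemma level_up n h u : H h -> level n u -> strips (h + u)%MM -> level n (h + u)%MM.
Proof.
move=> Hh [i [p [m [pG -> nm]]]] /(level_shift Hh pG)[q [m' [qG _ -> _]]].
by exists i, q, (m' + m)%N; split=> //; lia.
Qed.

(** If the multiple of [a i] did not grow, [h + p] would be a generator. Then [a i] cannot be split
    off [h], so [h] lies on neither ray, is interior, and is itself a generator: a sum which the
    hypothesis excludes. *)
Lemma level_lt_up n h u : H h -> h <> 0%MM ->
  (forall i p q, strip_gen i p -> strip_gen i q -> ~ strip_gen i (p + q)%MM) ->
  level n u -> strips (h + u)%MM -> level n.+1 (h + u)%MM.
Proof.
move=> Hh h0 sumG [i [p [m [pG -> nm]]]] hS.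
have [q [m' [qG hpE huE _]]] := level_shift Hh pG hS.
exists i, q, (m' + m)%N; split=> //.
suff : m' <> 0%N by lia.
move=> m'0; move: hpE; rewrite m'0 mulm0n addm0 => hpE.
have hpG : strip_gen i (h + p)%MM by rewrite hpE.
have ray_contra k : H k -> h <> (a i + k)%MM.
  move=> Hk hE; case: hpG => _; case; exists (k + p)%MM; last first.
    by rewrite hE addmC addmA addmC addmA (addmC k).
  by apply: intDl => //; case: pG => [[]].
have [lh|lh] := eqVneq (l i h) 0.
  have [[|k] hE] := facet_face D Hh lh; first by rewrite hE mulm0n in h0.
  by apply: (ray_contra (a i *+ k)%MM); rewrite -?mulmS //; exact: rayMn_mem.
have lt_h : l i h < l i b.
  by case: hpG => [[_]] + _; rewrite (facetD D); have := facet_gt0 i (proj1 (proj1 pG)); lia.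
(* A nonzero [h] on the other ray would have [l i h] at least [l i b]. *)
have oh : om h.
  apply/(facet_int D) => j; rewrite lt_neqAle facet_ge0 // andbT eq_sym.
  have [->//|ji] := eqVneq j i; apply/eqP => lj.
  have [[|k] hE] := facet_face D Hh lj; first by rewrite hE mulm0n in h0.
  by move: lt_h; rewrite hE facetMn (neq_negb ji); have := facet_bot_le_ray i;
    have := facet_rayN D i; nia.
have [q' [[|k] [q'G hE]]] := strip_decomp (conj oh lt_h : strip i h).
  by apply: (sumG i p h) => //; [rewrite hE mulm0n addm0|rewrite addmC].
apply: (ray_contra (q' + a i *+ k)%MM); last by rewrite hE mulmS Monoid.mulmCA.
by apply: int_mem; case: (strip_addray k (proj1 q'G)).
Qed.

(* A factor off the ray of [a i] may leave the level unchanged, but it raises the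
   bounded quantity [l i p]. *)
Definition weak_level n : set 'X_{1..2} :=
  [set u | exists i p m, [/\ strip_gen i p, u = (p + a i *+ m)%MM
                           & (n <= m + `|l i p|)%N]].

Lemma weak_level0 u : strips u -> weak_level 0 u.
Proof. by case=> i /strip_decomp[p [m [pG uE]]]; exists i, p, m. Qed.

Lemma weak_level_up n h u : H h -> h <> 0%MM ->
  weak_level n u -> strips (h + u)%MM -> weak_level n.+1 (h + u)%MM.
Proof.
move=> Hh h0 [i [p [m [pG -> nm]]]] hS.
have [lh|lh] := eqVneq (l i h) 0.
  have [[|k] hE] := facet_face D Hh lh; first by rewrite hE mulm0n in h0.
  exists i, p, (k.+1 + m)%N; split=> //; last by lia.
  by apply/mnmP => x; rewrite hE !mnmDE !mulmnE; lia.
have [q [m' [qG _ -> lE]]] := level_shift Hh pG hS.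
exists i, q, (m' + m)%N; split=> //.
have := facet_ge0 i Hh; have := facet_gt0 i (proj1 (proj1 pG)); lia.
Qed.

(** As [l i p < l i b], fewer than [l i b] factors are wasted; the sum of the two values serves both
    strips at once. *)
Lemma weak_levelW n u : weak_level n u ->
  level (n - (`|l true b| + `|l false b|)) u.
Proof.
case=> i [p [m [pG -> nm]]]; exists i, p, m; split=> //.
have := facet_gt0 i (proj1 (proj1 pG)); have := proj2 (proj1 pG).
by case: i {pG} nm; lia.
Qed.

Definition truncation n : seq 'X_{1..2} :=
  [seq (p + a true *+ m)%MM | p <- strip_gens true, m <- iota 0 n] ++
  [seq (p + a false *+ m)%MM | p <- strip_gens false, m <- iota 0 n].

Lemma truncationP n u : reflect
  (exists i p m, [/\ strip_gen i p, u = (p + a i *+ m)%MM & (m < n)%N])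
  (u \in truncation n).
Proof.
rewrite mem_cat; apply: (iffP orP).
  case=> /allpairsP[[p m] /= [/strip_gensP pG]]; rewrite mem_iota => mn ->;
  by [exists true, p, m|exists false, p, m].
case=> -[] [p [m [/strip_gensP pG -> mn]]]; [left|right];
by apply/allpairsP; exists (p, m); rewrite mem_iota.
Qed.

Lemma truncation_uniq n : uniq (truncation n).
Proof.
have U i : uniq [seq (p + a i *+ m)%MM | p <- strip_gens i, m <- iota 0 n].
  apply: allpairs_uniq; rewrite ?iota_uniq ?strip_gens_uniq //.
  move=> [p m] [p' m'] /allpairsP[[x y] /= [/strip_gensP xG _ [-> ->]]].
  move=> /allpairsP[[x' y'] /= [/strip_gensP xG' _ [-> ->]]] xE.
  by have [_ -> ->] := strip_decomp_inj xG xG' xE.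
rewrite cat_uniq !U andbT; apply/hasPn => u.
case/allpairsP => -[p m] [/strip_gensP pG _ ->] /=.
apply/negP => /allpairsP[[q k] [/strip_gensP qG _]] /= pq.
by have [] := strip_decomp_inj pG qG pq.
Qed.

Lemma size_truncation n : size (truncation n) = (size gens * n)%N.
Proof. by rewrite !size_cat !size_allpairs size_iota mulnDl. Qed.

Lemma mem_truncation n u : strips u -> (u \in truncation n <-> ~ level n u).
Proof.
move=> uS; split=> [/truncationP[i [p [m [pG -> mn]]]] [j [q [k [qG pq nk]]]]|nu].
  by have [_ _ mk] := strip_decomp_inj pG qG pq; lia.
case: uS => i /strip_decomp[p [m [pG uE]]].
apply/truncationP; exists i, p, m; split=> //; rewrite ltnNge.
by apply/negP => nm; apply: nu; exists i, p, m.
Qed.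

(** As long as some [h] with [l i h > 0] keeps [h + p] in the strips, the generator underlying
    [h + p] has a larger [l i], and [l i b] bounds these values. The monomial of the final [q] is
    killed by the face ideal of [i], which is what bounds the depth. *)
Lemma top_strip_gen i p : strip_gen i p ->
  exists2 q, strip_gen i q & forall h, H h -> 0 < l i h -> ~ strips (h + q)%MM.
Proof.
have [d] := ubnP (`|l i b| - `|l i p|); elim: d p => // d IH p pd pG.
have [top|] := pselect (forall h, H h -> 0 < l i h -> ~ strips (h + p)%MM).
  by exists p.
move/existsNP => [h /not_implyP[Hh /not_implyP[lh /contrapT hS]]].
have [|q [m' [qG _ _ lE]]] := @level_shift i p 0 h Hh pG.
  by rewrite mulm0n addm0.
apply: (IH q) => //.
have [[_ qb] _] := qG; have := facet_gt0 i (proj1 (proj1 pG)).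
by lia.
Qed.

(** Each form is at least 1 on [h] and on [v], so its value on the sum exceeds [l i b]. Interior
    monomials therefore act nilpotently on the quotient. *)
Lemma int_power_not_strips h v : om h -> om v ->
  ~ strips (h *+ (`|l true b| + `|l false b|) + v)%MM.
Proof.
move=> oh ov [i [_]]; rewrite (facetD D) facetMn.
have := facet_gt0 i oh; have := facet_gt0 i ov; case: i; nia.
Qed.

End Strips.

(** * The quotient of the canonical module has a monomial basis *)

Lemma mcoeffM_msupp n (R : nzRingType) (p q : {mpoly R[n]}) (h : 'X_{1..n}) :
  (p * q)@_h = \sum_(k <- msupp p)
    p@_k * (if (k <= h)%MM then q@_(h - k)%MM else 0).
Proof.
rewrite {1}[p]mpolyE mulr_suml raddf_sum; apply: eq_bigr => k _ /=.
rewrite -scalerAl mcoeffZ; congr (_ * _); rewrite -commr_mpolyX.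
case: ifP => kh; first by rewrite -{1}(submK kh) addmC mcoeffMX.
apply: memN_msupp_eq0; apply/negP => /msuppM_le /allpairsP[[u v] /= [_]].
by rewrite msuppX inE => /eqP -> hE; rewrite hE lem_addl in kh.
Qed.

Section SemigroupRing.
Variables (K : fieldType) (H : submonoid).
Local Notation R := (sring K H).
Local Notation inH := (submonoid_set H).
Implicit Types (r s : R) (h k : 'X_{1..2}).

(** Outside [H] the default value 0 is taken, so exponents carry no proof and membership reappears
    as a side condition. *)
Definition smon k : R := insubd (0 : R) 'X_[k].
Definition sconst (c : K) : R := insubd (0 : R) c%:MP.

Lemma sring_val_smon k : inH k -> sring_val (smon k) = 'X_[k].
Proof.
by move=> Hk; apply: insubdK; apply/asboolP => h; rewrite msuppX inE => /eqP ->.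
Qed.

Lemma sring_val_sconst c : sring_val (sconst c) = c%:MP.
Proof.
apply: insubdK; apply/asboolP => h; rewrite msuppC.
by case: eqP => // _; rewrite inE => /eqP ->; exact: submonoid0.
Qed.

Lemma sring_valD r s : sring_val (r + s) = sring_val r + sring_val s.
Proof. exact: (rmorphD (val : R -> _)). Qed.

Lemma sring_valB r s : sring_val (r - s) = sring_val r - sring_val s.
Proof. exact: (rmorphB (val : R -> _)). Qed.

Lemma sring_valM r s : sring_val (r * s) = sring_val r * sring_val s.
Proof. exact: (rmorphM (val : R -> _)). Qed.

Lemma sring_val0 : sring_val (0 : R) = 0.
Proof. exact: (rmorph0 (val : R -> _)). Qed.

Lemma sring_val1 : sring_val (1 : R) = 1.
Proof. exact: (rmorph1 (val : R -> _)). Qed.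

Lemma sring_val_sum I (t : seq I) (P : pred I) (f : I -> R) :
  sring_val (\sum_(i <- t | P i) f i) = \sum_(i <- t | P i) sring_val (f i).
Proof. exact: (rmorph_sum (val : R -> _)). Qed.

Lemma sring_val_inj : injective (@sring_val K H).
Proof. exact: val_inj. Qed.

Lemma sconst0 : sconst 0 = 0.
Proof. by apply: sring_val_inj; rewrite sring_val_sconst sring_val0 mpolyC0. Qed.

Lemma sring_msupp r k : k \in msupp (sring_val r) -> inH k.
Proof. by case: r => p /= /asboolP; apply. Qed.

Lemma sconstM_val c r : sring_val (sconst c * r) = c *: sring_val r.
Proof. by rewrite sring_valM sring_val_sconst mul_mpolyC. Qed.

Lemma sring_expand r :
  r = \sum_(k <- msupp (sring_val r)) sconst (sring_val r)@_k * smon k.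
Proof.
apply: sring_val_inj; rewrite sring_val_sum {1}[sring_val r]mpolyE.
rewrite big_seq [RHS]big_seq; apply: eq_bigr => k kr.
by rewrite sconstM_val sring_val_smon //; exact: sring_msupp kr.
Qed.

Lemma smonD h k : inH h -> inH k -> smon (h + k)%MM = smon h * smon k.
Proof.
move=> Hh Hk; apply: sring_val_inj.
by rewrite sring_valM !sring_val_smon ?mpolyXD //; exact: submonoidD.
Qed.

Lemma smon0 : smon 0%MM = 1.
Proof.
by apply: sring_val_inj; rewrite sring_val_smon ?mpolyX0 ?sring_val1 //; exact: submonoid0.
Qed.

Lemma sring_maxP r : sring_max r <-> (sring_val r)@_0%MM = 0.
Proof.
split.
  have sub : submodule [set r : R^o | (sring_val r)@_0%MM = 0].
    split; first by change ((sring_val (0 : R))@_0%MM = 0); rewrite sring_val0 mcoeff0.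
    move=> c x y /= x0 y0; change ((sring_val ((c : R) * x + y))@_0%MM = 0).
    rewrite sring_valD mcoeffD y0 addr0 sring_valM.
    by rewrite (rmorphM (mcoeff 0%MM)) /= x0 mulr0.
  apply: (span_min sub) => x [h [Hh h0 /= ->]].
  by rewrite mcoeffX; case: eqP.
move=> r0; rewrite [r]sring_expand.
apply: (@submodule_sum R R^o); first exact: span_submodule.
move=> k kr; apply: (@submoduleZ R R^o); first exact: span_submodule.
apply: subset_span_gen; exists k; split.
- exact: sring_msupp kr.
- by move=> k0; move: kr; rewrite k0 mcoeff_msupp r0 eqxx.
- exact: (sring_val_smon (sring_msupp kr)).
Qed.

Lemma smon_max k : inH k -> k <> 0%MM -> sring_max (smon k).
Proof. by move=> Hk k0; apply/sring_maxP; rewrite sring_val_smon // mcoeffX; case: eqP. Qed.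

(** The interface through which the quotient is used from here on. [E] is only an [R]-module, its
    [K]-structure being recovered through [sconst]. *)
Record monomial_basis (S : set 'X_{1..2}) (E : lmodType R)
    (coef : 'X_{1..2} -> E -> K) (mon : 'X_{1..2} -> E) : Prop := MonomialBasis {
  basis_coefD : forall h x y, coef h (x + y) = coef h x + coef h y;
  basis_coefZ : forall h r x, S h ->
    coef h (r *: x) = \sum_(k <- msupp (sring_val r))
      (sring_val r)@_k * (if (k <= h)%MM then coef (h - k)%MM x else 0);
  basis_coef_out : forall h x, ~ S h -> coef h x = 0;
  basis_coef_mon : forall h k, S h -> coef k (mon h) = (h == k)%:R;
  basis_span : forall x, exists t : seq _, x = \sum_(h <- t) sconst (coef h x) *: mon h
}.

End SemigroupRing.
Arguments smon {K H}.
Arguments sconst {K H}.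
Arguments sring_val_smon {K H k}.
Arguments sring_val_inj {K H}.

Section CanonicalQuotient.
Variables (F : realType) (K : fieldType) (H : submonoid) (b : 'X_{1..2}).
Variables (a : bool -> 'X_{1..2}) (l : bool -> 'X_{1..2} -> int).
Hypothesis D : two_facets H (omega F H) a b l.
Local Notation R := (sring K H).
Local Notation inH := (submonoid_set H).
Local Notation M := (canonical_mod K H F).
Local Notation N := (in_principal b : submodClosed M).
Local Notation Q := (quot_mod N).
Local Notation S := (strips (omega F H) b l).

Lemma canonical_msupp (v : M) h :
  h \in msupp (sring_val (canonical_val v)) -> omega F H h.
Proof. by case: v => p /= /asboolP; apply. Qed.

(** Two representatives differ by an element of [x^b R], whose exponents lie in [b + H] and so avoid
    the strips: there the coefficient does not depend on the choice. Elsewhere it may, hence the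
    value 0. *)
Definition quot_coef h (x : Q) : K :=
  if `[< S h >] then (sring_val (canonical_val (repr x)))@_h else 0.

Definition cmon h : M := insubd (0 : M) (smon h : R^o).

Definition quot_mon h : Q := \pi_Q%qT (cmon h).

Lemma cmon_val h : omega F H h -> canonical_val (cmon h) = smon h.
Proof.
move=> oh; apply: insubdK; apply/asboolP => k.
by rewrite [val _](sring_val_smon (int_mem D oh)) msuppX inE => /eqP ->.
Qed.

Lemma canonical_valD (u v : M) : canonical_val (u + v) = canonical_val u + canonical_val v.
Proof. exact: (raddfD (val : M -> _)). Qed.

Lemma canonical_valB (u v : M) : canonical_val (u - v) = canonical_val u - canonical_val v.
Proof. exact: (raddfB (val : M -> _)). Qed.

Lemma canonical_valZ (r : R) (u : M) : canonical_val (r *: u) = r * canonical_val u.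
Proof. by []. Qed.

Lemma quot_coef_pi h v : S h ->
  quot_coef h (\pi_Q%qT v) = (sring_val (canonical_val v))@_h.
Proof.
move=> Sh; rewrite /quot_coef asboolT //.
have : repr (\pi_Q%qT v) - v \in quot_pred N by rewrite Quotient.idealrBE reprK.
case/asboolP => r; rewrite canonical_valB sring_valB => rE.
apply/eqP; rewrite -subr_eq0 -mcoeffB rE -commr_mpolyX; apply/eqP.
apply: memN_msupp_eq0; apply/negP => /msuppM_le /allpairsP[[k k'] /= [kr]].
rewrite msuppX inE => /eqP -> hE; move: Sh; rewrite hE.
exact/(bot_notin_strips D)/(sring_msupp kr).
Qed.

Lemma quot_mon_basis : monomial_basis S
  (quot_coef : _ -> canonical_quot K H F b -> K)
  (quot_mon : _ -> canonical_quot K H F b).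
Proof.
split.
- move=> h; elim/quotW => u; elim/quotW => v.
  have [Sh|nS] := pselect (S h); last by rewrite /quot_coef asboolF // addr0.
  rewrite Defs.pi_add !quot_coef_pi //.
  by rewrite canonical_valD sring_valD mcoeffD.
- move=> h r; elim/quotW => v Sh.
  rewrite [r *: _]Defs.pi_scale quot_coef_pi //.
  rewrite canonical_valZ sring_valM mcoeffM_msupp big_seq [RHS]big_seq.
  apply: eq_bigr => k kr; congr (_ * _); case: ifP => // kh.
  (* If [h - k] is outside the strips it is not interior either, because [h] lies in a strip; both
     sides are then 0. *)
  have [Shk|nS] := pselect (S (h - k)%MM); first by rewrite quot_coef_pi.
  rewrite /quot_coef asboolF //; apply: memN_msupp_eq0.
  apply/negP => /canonical_msupp ohk; apply: nS; case: Sh => i iS; exists i.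
  apply: (strip_sub D (sring_msupp kr)) => //.
  by rewrite addmC submK.
- by move=> h x nS; rewrite /quot_coef asboolF.
- move=> h k Sh; have [Sk|nS] := pselect (S k); last first.
    by rewrite /quot_coef asboolF //; case: eqP => // hk; rewrite hk in Sh.
  have oh := strips_int Sh.
  rewrite quot_coef_pi // cmon_val // sring_val_smon ?mcoeffX //.
  exact: (int_mem D oh).
elim/quotW => v; exists (msupp (sring_val (canonical_val v))).
have vE : v = \sum_(h <- msupp (sring_val (canonical_val v)))
    sconst (sring_val (canonical_val v))@_h *: cmon h.
  apply: val_inj; rewrite (raddf_sum (val : M -> _)) /= {1}[canonical_val v]sring_expand.
  rewrite big_seq [RHS]big_seq; apply: eq_bigr => h hv.
  by rewrite cmon_val //; exact: canonical_msupp hv.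
rewrite {1}vE.
have pi0 : \pi_Q%qT (0 : M) = 0 :> Q.
  by apply: (addIr (\pi_Q%qT (0 : M) : Q)); rewrite add0r Defs.pi_add addr0.
have piS (s : seq 'X_{1..2}) (f : 'X_{1..2} -> M) :
    \pi_Q%qT (\sum_(h <- s) f h) = \sum_(h <- s) (\pi_Q%qT (f h) : Q).
  elim: s => [|h s IH]; first by rewrite !big_nil pi0.
  by rewrite !big_cons -IH -Defs.pi_add.
rewrite piS big_seq [RHS]big_seq; apply: eq_bigr => h hv.
rewrite -Defs.pi_scale.
have [Sh|nS] := pselect (S h); first by rewrite quot_coef_pi.
(* An interior exponent outside the strips lies in [b + H], so its monomial dies in the quotient. *)
suff q0 : quot_mon h = 0.
  by rewrite -/(quot_mon h) q0; exact: (etrans (scaler0 _ _) (esym (scaler0 _ _))).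
have oh := canonical_msupp hv.
have [k Hk hE] := not_strips D oh nS.
rewrite /quot_mon -pi0; apply/eqP.
rewrite -[_ == _](Quotient.idealrBE (quot_pred N)) subr0.
apply/asboolP; exists (smon k).
rewrite cmon_val // !sring_val_smon //; last exact: (int_mem D oh).
by rewrite hE addmC mpolyXD.
Qed.

End CanonicalQuotient.

(** * Modules with a monomial basis *)

Section MonomialModule.
Variables (K : fieldType) (H : submonoid) (S : set 'X_{1..2}).
Local Notation R := (sring K H).
Local Notation inH := (submonoid_set H).
Variables (E : lmodType R) (coef : 'X_{1..2} -> E -> K) (mon : 'X_{1..2} -> E).
Hypothesis B : monomial_basis S coef mon.
Implicit Types (r : R) (x y : E) (h k u : 'X_{1..2}) (T : set 'X_{1..2}).

Lemma basis_coef0 h : coef h 0 = 0.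
Proof.
by apply: (addIr (coef h 0)); rewrite -(basis_coefD B) addr0 add0r.
Qed.

Lemma basis_coefN h x : coef h (- x) = - coef h x.
Proof. by apply/eqP; rewrite -subr_eq0 opprK -(basis_coefD B) addNr basis_coef0. Qed.

Lemma basis_coefB h x y : coef h (x - y) = coef h x - coef h y.
Proof. by rewrite (basis_coefD B) basis_coefN. Qed.

Lemma basis_coef_sum h (I : Type) (t : seq I) (P : pred I) (f : I -> E) :
  coef h (\sum_(i <- t | P i) f i) = \sum_(i <- t | P i) coef h (f i).
Proof. exact: (big_morph (coef h) (basis_coefD B h) (basis_coef0 h)). Qed.

Lemma coef_supp h x : coef h x != 0 -> S h.
Proof. by move=> /eqP cx; apply: contrapT => nS; apply/cx/(basis_coef_out B). Qed.

Lemma coefZ_const h c x : coef h (sconst c *: x) = c * coef h x.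
Proof.
have [Sh|nS] := pselect (S h); last by rewrite !(basis_coef_out B) ?mulr0.
rewrite (basis_coefZ B) // sring_val_sconst msuppC.
case: eqP => [->|_]; first by rewrite big_nil mul0r.
have h0 : (0 <= h)%MM by apply/mnm_lepP => i; rewrite mnm0E.
by rewrite big_seq1 mcoeffC eqxx mulr1 h0 subm0.
Qed.

Lemma coefZ_neq0 h r x : coef h (r *: x) != 0 ->
  exists k u, [/\ k \in msupp (sring_val r), h = (k + u)%MM & coef u x != 0].
Proof.
move=> cx; have Sh := coef_supp cx.
apply: contrapT => nex; case/eqP: cx; rewrite (basis_coefZ B) // big_seq.
apply: big1 => k kr; case: ifP => [kh|]; last by rewrite mulr0.
have [->|cu] := eqVneq (coef (h - k)%MM x) 0; first by rewrite mulr0.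
by case: nex; exists k, (h - k)%MM; rewrite addmC submK.
Qed.

Lemma coef_smonD k u x : inH k -> S (k + u)%MM ->
  coef (k + u)%MM (smon k *: x) = coef u x.
Proof.
move=> Hk Sku; rewrite (basis_coefZ B) // sring_val_smon // msuppX big_seq1 mcoeffX eqxx.
by rewrite lem_addr mul1r addmC addmK.
Qed.

Lemma coef_smon_neq0 k h x : inH k -> coef h (smon k *: x) != 0 ->
  exists2 u, h = (k + u)%MM & coef u x != 0.
Proof.
move=> Hk /coefZ_neq0[k' [u []]]; rewrite sring_val_smon // msuppX inE => /eqP ->.
by exists u.
Qed.

Lemma coef_mulmon h p r : S h -> S p ->
  coef h (r *: mon p) = if (p <= h)%MM then (sring_val r)@_(h - p)%MM else 0.
Proof.
move=> Sh Sp; rewrite (basis_coefZ B) //.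
transitivity (sring_val r * 'X_[p])@_h.
  rewrite mcoeffM_msupp; apply: eq_bigr => k _; case: ifP => // _.
  by rewrite (basis_coef_mon B) // mcoeffX.
rewrite commr_mpolyX mcoeffM_msupp msuppX big_seq1 mcoeffX eqxx mul1r.
by [].
Qed.

Lemma sconst_mon_ind (L : set E) x : submodule L ->
  (forall h, coef h x != 0 -> L (mon h)) -> L x.
Proof.
move=> sL LP; have [t xE] := basis_span B x; rewrite xE.
apply: submodule_sum => // h _.
have [->|cx] := eqVneq (coef h x) 0; last by apply: submoduleZ (LP _ cx).
by rewrite sconst0 scale0r; case: sL.
Qed.

Lemma basis_coef_eq0 x : (forall h, coef h x = 0) -> x = 0.
Proof.
move=> x0; apply: (@sconst_mon_ind [set 0]); first exact: submodule_set1.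
by move=> h; rewrite x0 eqxx.
Qed.

Lemma smon_mon k h : inH k -> S h -> S (k + h)%MM ->
  smon k *: mon h = mon (k + h)%MM.
Proof.
move=> Hk Sh Skh; apply/eqP; rewrite -subr_eq0; apply/eqP/basis_coef_eq0 => u.
have [Su|nS] := pselect (S u); last exact: (basis_coef_out B).
rewrite basis_coefB (basis_coef_mon B) //; apply/eqP; rewrite subr_eq0; apply/eqP.
rewrite coef_mulmon // sring_val_smon // mcoeffX.
case: ifP => hu; first by rewrite -{2}(submK hu) eqm_add2r.
by case: eqP => // uE; rewrite -uE lem_addl in hu.
Qed.

Definition coef_in T : set E := [set x | forall h, coef h x != 0 -> T h].

Lemma coef_in_submodule T :
  (forall k u, inH k -> S u -> T u -> S (k + u)%MM -> T (k + u)%MM) ->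
  submodule (coef_in T).
Proof.
move=> TH; split; first by move=> h; rewrite basis_coef0 eqxx.
move=> r x y xT yT h cxy.
have [rx0|/coefZ_neq0[k [u [kr hE cu]]]] := eqVneq (coef h (r *: x)) 0.
  by apply: yT; move: cxy; rewrite (basis_coefD B) rx0 add0r.
have Sh := coef_supp cxy; rewrite hE in Sh *; apply: TH => //.
- exact: sring_msupp kr.
- exact: coef_supp cu.
- exact: xT.
Qed.

(** * Colength of the submodule vanishing on a finite divisor-closed set of exponents *)

Section Length.
Variable t : seq 'X_{1..2}.
Hypothesis t_uniq : uniq t.
Hypothesis t_S : forall h, h \in t -> S h.
Hypothesis t_down : forall k u, inH k -> S u -> (k + u)%MM \in t -> u \in t.

Let N : set E := [set x | forall h, h \in t -> coef h x = 0].

(** Sort [t] decreasingly for the total monomial order and release the conditions one at a time, the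
    largest exponent going out of force earliest. Multiplication only raises exponents, so each
    stage is a submodule; the released monomial witnesses strictness. *)
Lemma length_coef_ge : exists F,
  strict_chain [set L : set E | submodule L /\ N `<=` L] F (size t).
Proof.
pose ge : rel 'X_{1..2} := fun h k => (k <= h)%O.
pose s := sort ge t.
have s_mem h : (h \in s) = (h \in t) by rewrite mem_sort.
have s_uniq : uniq s by rewrite sort_uniq.
have s_sort : pairwise ge s.
  rewrite -sorted_pairwise; first by apply: sort_sorted => h k; exact: le_total.
  by move=> y x z yx zy; exact: le_trans zy yx.
pose F i : set E := [set x | forall h, h \in drop i s -> coef h x = 0].
exists F; split=> [i _|i].
  split; last by move=> x xN h /mem_drop; rewrite s_mem; apply: xN.
  have FE : F i = coef_in [set h | h \notin drop i s].
    apply/seteqP; split=> x xF h; first by apply: contraTN => /xF ->; rewrite eqxx.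
    by move=> hd; apply/eqP; apply: contraTT hd => /xF.
  rewrite FE; apply: coef_in_submodule => k u Hk Su /= ud Sku.
  apply: contra ud => kud.
  have us : u \in take i s ++ drop i s.
    by rewrite cat_take_drop s_mem (t_down Hk) // -s_mem (mem_drop kud).
  move: us; rewrite mem_cat => /orP[ut|//].
  move: s_sort; rewrite -{1}(cat_take_drop i s) pairwise_cat.
  case/and3P => /allrelP/(_ u _ ut kud); rewrite /ge => ku _ _.
  suff kuE : (k + u)%MM = u by rewrite kuE in kud.
  by apply/le_anti; rewrite ku lemc_addl.
rewrite -(size_sort ge) => it; split.
  move=> x xF h hd; apply: xF; rewrite -(cat_take_drop 1 (drop i s)).
  by rewrite drop_drop mem_cat add1n hd orbT.
have si : nth 0%MM s i \in s by exact: mem_nth.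
have Si : S (nth 0%MM s i) by apply: t_S; rewrite -s_mem.
have E1 : drop i s = nth 0%MM s i :: drop i.+1 s by rewrite -drop_nth.
have := drop_uniq i s_uniq; rewrite E1 /= => /andP[s_nin _].
move=> /(_ (mon (nth 0%MM s i))) FF; suff /FF : F i.+1 (mon (nth 0%MM s i)).
  move=> /(_ (nth 0%MM s i)); rewrite E1 inE eqxx => /(_ isT).
  by rewrite (basis_coef_mon B) // eqxx; apply/eqP/oner_neq0.
move=> h hd; rewrite (basis_coef_mon B) //.
by case: eqP => // sh; rewrite sh hd in s_nin.
Qed.

(** Linear algebra over [K]: pick [v i] in [F i.+1] outside [F i]. With more vectors than
    coordinates, some nontrivial combination lies in [N], hence in every [F i]; for the last index
    [i] with nonzero coefficient this puts [v i] into [F i]. *)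
Lemma length_coef_le F n :
  strict_chain [set L : set E | submodule L /\ N `<=` L] F n -> (n <= size t)%N.
Proof.
move=> [FQ Flt]; rewrite leqNgt; apply/negP => tn.
have /choice[v vP] : forall i, exists x, (i < n)%N -> F i.+1 x /\ ~ F i x.
  move=> i; have [lt_in|] := boolP (i < n)%N; last by exists 0.
  by have [_ /existsNP[x /not_implyP xP]] := Flt i lt_in; exists x.
pose V : 'M[K]_(n, size t) := \matrix_(i, j) coef (nth 0%MM t j) (v i).
have : kermx V != 0.
  by rewrite kermx_eq0 /row_free neq_ltn (leq_ltn_trans (rank_leq_col V)).
case/rowV0Pn => c /sub_kermxP cV /rV0Pn[i0 ci0].
have [i ci imax] := @arg_maxnP _ i0 (fun i => c 0 i != 0) (fun i => i : nat) ci0.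
have Fmono (j k : nat) : (j <= k)%N -> (k <= n)%N -> F j `<=` F k.
  elim: k => [|k IH]; first by rewrite leqn0 => /eqP -> _ x.
  rewrite leq_eqVlt => /orP[/eqP -> _ x //|jk] kn.
  exact: subset_trans (IH jk (ltnW kn)) (proj1 (Flt k kn)).
have [sF NF] := FQ i (ltnW (ltn_ord i)).
have xN : N (\sum_j sconst (c 0 j) *: v j).
  move=> h ht; rewrite basis_coef_sum.
  move: cV => /rowP/(_ (Ordinal (etrans (index_mem h t) ht : (_ < _)%N))).
  rewrite !mxE => cV; rewrite -[RHS]cV; apply: eq_bigr => j _.
  by rewrite coefZ_const !mxE nth_index.
case: (vP i (ltn_ord i)) => _ [].
have c1 : sconst (c 0 i)^-1 * sconst (c 0 i) = 1 :> R.
  apply: sring_val_inj.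
  by rewrite sring_valM !sring_val_sconst sring_val1 -mpolyCM mulVf.
rewrite -[v i]scale1r -c1 -scalerA; apply: submoduleZ => //.
rewrite [X in F i X](_ : _ = \sum_j sconst (c 0 j) *: v j -
    \sum_(j | j != i) sconst (c 0 j) *: v j); last first.
  by rewrite (bigD1 i) //= addrK.
apply: submoduleB => //; first exact: NF.
rewrite big_mkcond; apply: submodule_sum => // j _.
case: ifP => ji; last by case: sF.
have [ltj|lej] := ltnP j i.
  apply: submoduleZ => //; apply: (Fmono j.+1 i) => //; first exact: ltnW.
  by case: (vP j (ltn_ord j)).
have [cj|cj] := eqVneq (c 0 j) 0.
  by rewrite cj sconst0 scale0r; case: sF.
suff jE : j = i by rewrite jE eqxx in ji.
by apply/val_inj/eqP; rewrite eqn_leq lej andbT; exact: imax.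
Qed.

Lemma quot_length_coef : quot_length N (size t).
Proof. by split; [exact: length_coef_ge|exact: length_coef_le]. Qed.
End Length.
End MonomialModule.

(** * Generators and multiplicity *)

Section StripModule.
Variables (K : fieldType) (H : submonoid) (om : set 'X_{1..2}).
Variables (a : bool -> 'X_{1..2}) (b : 'X_{1..2}).
Variables (l : bool -> 'X_{1..2} -> int).
Hypothesis D : two_facets H om a b l.
Local Notation S := (strips om b l).
Local Notation R := (sring K H).
Local Notation inH := (submonoid_set H).
Local Notation gens := (gens om a b l).
Local Notation strip_gen := (strip_gen om a b l).
Local Notation level := (level om a b l).
Variables (E : lmodType R) (coef : 'X_{1..2} -> E -> K) (mon : 'X_{1..2} -> E).
Hypothesis B : monomial_basis S coef mon.
Local Notation m := (@sring_max K H).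
Implicit Types (r : R) (x y : E) (h k u p : 'X_{1..2}) (T : set 'X_{1..2}).

Lemma gen_strips i p : strip_gen i p -> S p.
Proof. by case=> pS _; exists i. Qed.

Lemma mon_neq0 p : S p -> mon p <> 0.
Proof.
move=> Sp /(congr1 (coef p)); rewrite (basis_coef_mon B) // (basis_coef0 B) eqxx.
exact/eqP/oner_neq0.
Qed.

Lemma quot_length_level n : quot_length (coef_in coef (level n)) (size gens * n).
Proof.
have -> : coef_in coef (level n) =
    [set x | forall h, h \in truncation om a b l n -> coef h x = 0].
  apply/seteqP; split=> x xP h.
    move=> ht; apply: contrapT => /eqP ch.
    exact: (proj1 (mem_truncation D n (coef_supp B ch)) ht (xP _ ch)).
  move=> ch; have Sh := coef_supp B ch; apply: contrapT.
  by move=> /(proj2 (mem_truncation D n Sh))/xP c0; rewrite c0 eqxx in ch.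
rewrite -(size_truncation om a b l n); apply: (quot_length_coef B).
- exact: (truncation_uniq D).
- move=> h /(truncationP D)[i [p [k [pG -> _]]]].
  by exists i; apply: (strip_addray D); case: pG.
move=> k u Hk Su kut; apply/(mem_truncation D) => // lu.
have Sku : S (k + u)%MM.
  case/(truncationP D): kut => i [p [j [pG -> _]]].
  by exists i; apply: (strip_addray D); case: pG.
by apply: (proj1 (mem_truncation D n Sku) kut); apply: (level_up D).
Qed.

(** Applied to [weak_level] in general and to [level] in the sum-free case. That [T] decreases
    handles the factor [k = 0], which need not raise the level. *)
Lemma smul_pow_sub (T : nat -> set 'X_{1..2}) n : S `<=` T 0%N ->
  (forall n, T n.+1 `<=` T n) ->
  (forall n k u, inH k -> k <> 0%MM -> T n u -> S (k + u)%MM -> T n.+1 (k + u)%MM) ->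
  smul_pow E m n `<=` coef_in coef (T n).
Proof.
move=> T0 TS Tup; elim: n => [|n IH] /=.
  by move=> x _ h /(coef_supp B)/T0.
apply: smul_min.
  apply: (coef_in_submodule B) => k u Hk _ Tu Sku.
  have [k0|/eqP k0] := eqVneq k 0%MM; first by rewrite k0 add0m.
  by apply: Tup => //; apply: TS.
move=> r x /sring_maxP r0 /IH xT h crx.
have Sh := coef_supp B crx.
have [k [u [kr hE cu]]] := coefZ_neq0 B crx; rewrite hE in Sh *; apply: Tup => //.
- exact: sring_msupp kr.
- by move=> k0; move: kr; rewrite k0 mcoeff_msupp r0 eqxx.
- exact: xT.
Qed.

Lemma smul_pow_sub_weak n :
  smul_pow E m n `<=` coef_in coef (level (n - (`|l true b| + `|l false b|))).
Proof.
have : smul_pow E m n `<=` coef_in coef (weak_level om a b l n).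
  apply: smul_pow_sub => [u|k u|k h u Hh h0].
  - exact: (weak_level0 D).
  - by case=> i [p [j [pG uE kj]]]; exists i, p, j; split=> //; apply: ltnW.
  - exact: (weak_level_up D Hh h0).
by move=> sub x /sub xP h /xP; exact: (weak_levelW D).
Qed.

Lemma level_sub_smul_pow n : coef_in coef (level n) `<=` smul_pow E m n.
Proof.
move=> x xP; apply: (sconst_mon_ind B); first exact: smul_pow_submodule.
move=> h /xP; elim: n {x xP} h => //= n IH h /[dup] /(level_strips D) Sh.
move=> /(levelS D)[i [v [lv Sv hE]]].
rewrite hE in Sh *; rewrite -(smon_mon B) //; last exact: ray_mem D i.
apply: smulI; last exact: IH.
by apply: smon_max; [exact: ray_mem D i|exact: ray_neq0 D i].
Qed.

Lemma strips_gens h : S h -> exists i p n, [/\ strip_gen i p, p \in gens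
  & h = (p + a i *+ n)%MM].
Proof.
case=> i /(strip_decomp D)[p [n [pG hE]]]; exists i, p, n; split=> //.
by apply/(gensP D); exists i.
Qed.

Lemma gens_nil : gens = [::] -> forall x, x = 0.
Proof.
move=> g0 x; apply: (basis_coef_eq0 B) => h; apply: contrapT => /eqP ch.
by have [i [p [n []]]] := strips_gens (coef_supp B ch); rewrite g0.
Qed.

Lemma span_gens (s : seq 'X_{1..2}) :
  (forall p, p \in gens -> span [set` [seq mon h | h <- s]] (mon p)) ->
  span [set` [seq mon h | h <- s]] = setT.
Proof.
move=> sP; apply/seteqP; split=> // x _.
apply: (sconst_mon_ind B); first exact: span_submodule.
move=> h ch; have Sh := coef_supp B ch.
have [i [p [n [pG pg hE]]]] := strips_gens Sh.
rewrite hE addmC in Sh *; rewrite -(smon_mon B) //.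
- by apply: submoduleZ (sP _ pg); exact: span_submodule.
- exact: rayMn_mem D i n.
- exact: gen_strips pG.
Qed.

(** The colength of [m^(n+1) E] is squeezed between two linear functions of slope [size gens], so
    [P] is linear with that slope. Its size then forces [d = 1], whence the factorial is 1. *)
Lemma multiplicity_gens e : (0 < size gens)%N ->
  multiplicity m E e -> e = size gens.
Proof.
move=> g0 [d [P [_ sP lP [N NP]]]].
have [k PE] : exists k : rat, P = (size gens)%:R *: 'X + k%:P.
  apply: (@poly_of_linear_growth _ _ (`|l true b| + `|l false b|) N) => n Nn.
  have [len [qlen ->]] := NP n Nn; exists len; split=> //; apply/andP; split.
    exact: quot_length_mono (@smul_pow_sub_weak _) qlen (quot_length_level _).
  exact: quot_length_mono (@level_sub_smul_pow _) (quot_length_level _) qlen.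
have e0 : (size gens)%:R != 0 :> rat by rewrite pnatr_eq0 -lt0n.
have PE' : P = (size gens)%:R%:P * 'X + k%:P by rewrite PE mul_polyC.
have sP2 : size P = 2 by rewrite PE' size_MXaddC polyC_eq0 (negbTE e0) size_polyC e0.
have lcP : lead_coef P = (size gens)%:R by rewrite lead_coefE sP2 PE !coefE /= mulr1 addr0.
move: lP; rewrite lcP; have -> : d = 1%N by move: sP; rewrite sP2 => -[].
by rewrite mulr1 => /eqP; rewrite eqr_nat => /eqP.
Qed.

(** If [p + q] were a generator, [x^(p + q) = x^q x^p] would be redundant, and removing it from
    [gens] would leave a generating list shorter than the multiplicity. *)
Lemma ulrich_sum_gen i p q : ulrich m E ->
  strip_gen i p -> strip_gen i q -> ~ strip_gen i (p + q)%MM.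
Proof.
move=> U pG qG pqG; case: U => [E0|[_ [e [[_ emin] /multiplicity_gens eE]]]].
  exact: (mon_neq0 (gen_strips pG)) (E0 _).
have pg : p \in gens by apply/(gensP D); exists i.
have pqg : (p + q)%MM \in gens by apply/(gensP D); exists i.
have Hq : inH q by case: qG => [[oq _] _]; exact: (int_mem D oq).
have ppq : p != (p + q)%MM.
  apply/eqP => pE; have q0 : q = 0%MM by apply: (@addmI _ p); rewrite addm0.
  by have := facet_gt0 D i (proj1 (proj1 qG)); rewrite q0 (facet0 D).
have := emin [seq mon h | h <- rem (p + q)%MM gens].
rewrite size_map size_rem // eE; last by case: gens pg.
have g0 : (0 < size gens)%N by case: gens pg.
rewrite leqNgt ltn_predL g0 => /(_ _)/negP; apply=> //.
apply: span_gens => h hg.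
have memP k : k \in rem (p + q)%MM gens ->
    span [set` [seq mon u | u <- rem (p + q)%MM gens]] (mon k).
  by move=> kr; apply: subset_span_gen => /=; apply: map_f.
have [->|hpq] := eqVneq h (p + q)%MM; last first.
  by apply: memP; rewrite mem_rem_uniq ?inE ?hpq //; exact: gens_uniq D.
rewrite -(_ : smon q *: mon p = mon (p + q)%MM); last first.
  by rewrite addmC (smon_mon B) ?(addmC q) //; [exact: gen_strips pG|exact: gen_strips pqG].
apply: submoduleZ; first exact: span_submodule.
by apply: memP; rewrite mem_rem_uniq ?inE ?ppq //; exact: (gens_uniq D).
Qed.

(** * The case where no [strip_gen i] contains a sum of two of its elements *)

Section SumFree.
Hypothesis sum_gen : forall i p q,
  strip_gen i p -> strip_gen i q -> ~ strip_gen i (p + q)%MM.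

Lemma smul_pow_level n : smul_pow E m n = coef_in coef (level n).
Proof.
apply/seteqP; split; last exact: level_sub_smul_pow.
apply: smul_pow_sub => [u|k u|k h u Hh h0].
- exact: (level0 D).
- by case=> i [p [j [pG uE kj]]]; exists i, p, j; split=> //; apply: ltnW.
- exact: (level_lt_up D Hh h0 sum_gen).
Qed.

(** Subtracting its constant term puts [r] into [m], and [m E] is the span of level 1, which
    contains no generator. So the coefficients at [gens] are coordinates on [E / m E]. *)
Lemma coef_gen p r x : p \in gens ->
  coef p (r *: x) = (sring_val r)@_0%MM * coef p x.
Proof.
move=> pg; rewrite -[r in LHS](subrK (sconst (sring_val r)@_0%MM)) scalerDl.
rewrite (basis_coefD B) (coefZ_const B); set r' := r - _.
suff -> : coef p (r' *: x) = 0 by rewrite add0r.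
apply: contrapT => /eqP cp.
have : smul_pow E m 1 (r' *: x).
  apply: smulI => //; apply/sring_maxP.
  by rewrite sring_valB mcoeffB sring_val_sconst mcoeffC eqxx mulr1 subrr.
rewrite smul_pow_level => /(_ p cp) [i [q [n [qG pE n0]]]].
have /(gensP D)[j pG] := pg.
have [|_ _ nE] := @strip_decomp_inj _ _ _ _ _ D j i p q 0 n pG qG.
  by rewrite mulm0n addm0.
by rewrite -nE in n0.
Qed.

(** A generating list spans [E / m E]: by [coef_gen], each unit row is a [K]-combination of rows of
    [A], so [A] has rank [size gens], at most its number of rows. *)
Lemma min_generators_gens : min_generators E (size gens).
Proof.
split.
  exists [seq mon p | p <- gens]; rewrite size_map; split=> //.
  by apply: span_gens => p pg; apply: subset_span_gen => /=; apply: map_f.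
move=> s sT; pose A : 'M[K]_(size s, size gens) :=
  \matrix_(i, j) coef (nth 0%MM gens j) (nth 0 s i).
apply: leq_trans (rank_leq_row A); rewrite -[leqLHS](mxrank1 K).
apply/mxrankS/row_subP => j.
have : span [set` s] (mon (nth 0%MM gens j)) by rewrite sT.
have jg : nth 0%MM gens j \in gens by exact: mem_nth.
have Sj : S (nth 0%MM gens j).
  by have /(gensP D)[i jG] := jg; exact: gen_strips jG.
case=> t [ts jE].
have -> : row j 1%:M = \sum_(q <- t) (sring_val q.1)@_0%MM *:
    \row_k coef (nth 0%MM gens k) q.2 :> 'rV[K]_(size gens).
  apply/rowP => k; rewrite summxE !mxE.
  have := basis_coef_mon B (nth 0%MM gens k) Sj.
  rewrite nth_uniq //; last exact: gens_uniq D.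
  rewrite (_ : (j == k :> nat) = (j == k)) // => <-.
  rewrite jE (basis_coef_sum B); apply: eq_bigr => q _.
  by rewrite !mxE coef_gen //; exact: mem_nth.
rewrite big_seq; apply: summx_sub => q /ts /= qs; apply: scalemx_sub.
rewrite (_ : \row_k _ = row (Ordinal (etrans (index_mem q.2 s) qs : (_ < _)%N)) A).
  exact: row_sub.
by apply/rowP => k; rewrite !mxE nth_index.
Qed.

Lemma multiplicity_sum_free : (0 < size gens)%N -> krull_dim E 1 ->
  multiplicity m E (size gens).
Proof.
move=> g0 kd; have e0 : (size gens)%:R != 0 :> rat by rewrite pnatr_eq0 -lt0n.
(* The constant term equals the slope because the Hilbert-Samuel function at [n] involves
   [m^(n+1)]. *)
exists 1%N, ((size gens)%:R%:P * 'X + (size gens)%:R%:P).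
have sP : size ((size gens)%:R%:P * 'X + (size gens)%:R%:P : {poly rat}) = 2.
  by rewrite size_MXaddC polyC_eq0 (negbTE e0) size_polyC e0.
split=> //; first by rewrite lead_coefE sP !coefE /= !mulr1 addr0.
exists 0%N => n _; exists (size gens * n.+1)%N; split.
  by rewrite smul_pow_level; exact: quot_length_level.
by rewrite !hornerE natrM -natr1 mulrDr mulr1.
Qed.

End SumFree.
End StripModule.

(** * The prime ideals of the two facets *)

Section PrimeIdeals.
Variables (R : comNzRingType) (P : set R).
Hypothesis primeP : prime_ideal P.

Let idealP : @submodule R R^o P. Proof. by case: primeP. Qed.

Lemma prime_idealMl x y : P y -> P (x * y).
Proof. exact: (submoduleZ (E := R^o) (L := P) x idealP). Qed.

Lemma prime_idealX x n : P (x ^+ n) -> P x.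
Proof.
case: primeP => _ P1 PM; elim: n => [|n IH]; first by rewrite expr0 => /P1.
by rewrite exprS => /PM[].
Qed.

End PrimeIdeals.

Section FaceIdeal.
Variables (K : fieldType) (H : submonoid) (om : set 'X_{1..2}).
Variables (a : bool -> 'X_{1..2}) (b : 'X_{1..2}).
Variables (l : bool -> 'X_{1..2} -> int).
Hypothesis D : two_facets H om a b l.
Local Notation R := (sring K H).
Local Notation inH := (submonoid_set H).
Local Notation m := (@sring_max K H).
Implicit Types (r s : R) (h k u p : 'X_{1..2}) (i : bool) (f g : {poly K}).

(* The kernel of the projection of [R] to the polynomial ring [K[x^(a i)]]. *)
Definition face_ideal i : set R :=
  [set r | forall k, k \in msupp (sring_val r) -> l i k != 0].

Lemma face_ideal_ideal i : ideal (face_ideal i).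
Proof.
split; first by move=> k; rewrite [X in msupp X]sring_val0 msupp0.
move=> r s t Ps Pt k; rewrite [X in msupp X]sring_valD => /msuppD_le.
rewrite mem_cat => /orP[|/Pt//]; rewrite sring_valM.
move=> /msuppM_le /allpairsP[[u v] /= [ur vs ->]].
have := Ps _ vs; have := facet_ge0 D i (sring_msupp ur).
have := facet_ge0 D i (sring_msupp vs); rewrite (facetD D).
by move: (l i u) (l i v) => x y; lia.
Qed.

Lemma face_idealB i r s : face_ideal i r -> face_ideal i s -> face_ideal i (r - s).
Proof. exact: (submoduleB (E := R^o) (L := face_ideal i) (face_ideal_ideal i)). Qed.

Lemma face_idealMl i r s : face_ideal i s -> face_ideal i (r * s).
Proof. exact: (submoduleZ (E := R^o) (L := face_ideal i) r (face_ideal_ideal i)). Qed.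

Lemma submonoidMn k n : inH k -> inH (k *+ n)%MM.
Proof.
move=> Hk; elim: n => [|n IH]; first by rewrite mulm0n; exact: submonoid0.
by rewrite mulmS; exact: submonoidD.
Qed.

Lemma smonX k n : inH k -> smon (k *+ n)%MM = smon k ^+ n :> R.
Proof.
move=> Hk; elim: n => [|n IH]; first by rewrite mulm0n smon0.
by rewrite mulmS exprS -IH smonD //; exact: submonoidMn.
Qed.

Lemma ray_mulm_inj i (n k : nat) : (a i *+ n)%MM = (a i *+ k)%MM -> n = k.
Proof.
move=> /(congr1 (l (~~ i))); rewrite !(facetMn D) => nk.
by have := facet_rayN D (~~ i); rewrite negbK; nia.
Qed.

(** The section [f |-> f(x^(a i))] of this projection. *)
Definition face_poly i f : R := insubd (0 : R) (map_poly (@mpolyC 2 K) f).['X_[a i]].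

Lemma face_poly_coef i f k : ((map_poly (@mpolyC 2 K) f).['X_[a i]])@_k =
  \sum_(j < size f) f`_j * ((a i *+ j)%MM == k)%:R.
Proof.
rewrite horner_coef size_map_poly raddf_sum; apply: eq_bigr => j _ /=.
by rewrite coef_map /= mul_mpolyC mcoeffZ mpolyXn mcoeffX.
Qed.

Lemma sring_val_face_poly i f :
  sring_val (face_poly i f) = (map_poly (@mpolyC 2 K) f).['X_[a i]].
Proof.
apply: insubdK; apply/asboolP => h; rewrite mcoeff_msupp face_poly_coef => hf.
apply: contrapT => nH; case/eqP: hf; apply: big1 => j _.
case: eqP => [hE|]; last by rewrite mulr0.
by case: nH; rewrite -hE; exact: (rayMn_mem D).
Qed.

Lemma face_polyM i f g : face_poly i (f * g) = face_poly i f * face_poly i g.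
Proof.
apply: sring_val_inj.
by rewrite sring_valM !sring_val_face_poly rmorphM hornerM.
Qed.

Lemma face_polyD i f g : face_poly i (f + g) = face_poly i f + face_poly i g.
Proof.
apply: sring_val_inj.
by rewrite sring_valD !sring_val_face_poly rmorphD hornerD.
Qed.

Lemma face_polyC i c : face_poly i c%:P = sconst c.
Proof.
by apply: sring_val_inj; rewrite sring_val_face_poly map_polyC hornerC sring_val_sconst.
Qed.

Lemma face_polyX i : face_poly i 'X = smon (a i).
Proof.
apply: sring_val_inj.
by rewrite sring_val_face_poly map_polyX hornerX sring_val_smon //; exact: (ray_mem D).
Qed.

Lemma coef_face_poly i f n : (sring_val (face_poly i f))@_(a i *+ n)%MM = f`_n.
Proof.
rewrite sring_val_face_poly face_poly_coef.
have [nf|nf] := ltnP n (size f).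
  rewrite (bigD1 (Ordinal nf)) //= eqxx mulr1 big1 ?addr0 // => j jn.
  case: eqP => [/ray_mulm_inj jE|]; last by rewrite mulr0.
  by move: jn; rewrite -val_eqE /= jE eqxx.
rewrite nth_default // big1 // => j _.
case: eqP => [/ray_mulm_inj jE|]; last by rewrite mulr0.
by move: (ltn_ord j); rewrite jE ltnNge nf.
Qed.

Lemma face_poly_surj i r : exists f, face_ideal i (r - face_poly i f).
Proof.
(* Since [a i] has positive degree, the coefficients of [r] at [a i *+ j] with [j] beyond [msize]
   vanish. *)
exists (\poly_(j < msize (sring_val r)) (sring_val r)@_(a i *+ j)%MM).
move=> k kr; apply/eqP => lk; have [j kE] := facet_face D (sring_msupp kr) lk.
move: kr; rewrite kE mcoeff_msupp sring_valB mcoeffB coef_face_poly coef_poly.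
case: ltnP => jr; first by rewrite subrr eqxx.
rewrite subr0 (memN_msupp_eq0 _) ?eqxx //; apply: msize_mdeg_ge.
apply: leq_trans jr _; rewrite mdegMn.
have : (0 < mdeg (a i))%N by rewrite lt0n mdeg_eq0; apply/eqP/(ray_neq0 D).
by nia.
Qed.

Lemma face_poly_ideal i f : face_ideal i (face_poly i f) -> f = 0.
Proof.
move=> fP; apply/polyP => n; rewrite coef0 -(coef_face_poly i).
apply: memN_msupp_eq0; apply/negP => /fP.
by rewrite (facet_rayMn D) eqxx.
Qed.

(** Modulo the ideal, [r] and [s] become polynomials [f] and [g], and [K[X]] is a domain. *)
Lemma face_ideal_prime i : prime_ideal (face_ideal i).
Proof.
split; first exact: face_ideal_ideal.
  move=> /(_ 0%MM); rewrite sring_val1 msupp1 inE eqxx => /(_ isT).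
  by rewrite (facet0 D).
move=> r s rs.
have [f rf] := face_poly_surj i r; have [g sg] := face_poly_surj i s.
have : face_ideal i (face_poly i (f * g)).
  rewrite [face_poly i _](_ : _ = r * s - (s * (r - face_poly i f) +
    face_poly i f * (s - face_poly i g))); last by rewrite face_polyM; ring.
  apply: face_idealB => //.
  by apply: (submoduleD (E := R^o) (L := face_ideal i) (face_ideal_ideal i));
    exact: face_idealMl.
move=> /face_poly_ideal/eqP; rewrite mulf_eq0 => /orP[] /eqP fg0.
  by left; move: rf; rewrite fg0 -(polyC0 K) face_polyC sconst0 subr0.
by right; move: sg; rewrite fg0 -(polyC0 K) face_polyC sconst0 subr0.
Qed.
End FaceIdeal.
Arguments face_polyX {K H om a b l}.
Arguments face_polyC {K H om a b l}.
Arguments face_ideal_prime {K H om a b l}.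

(** * Krull dimension and depth *)

Section KrullDepth.
Variables (K : fieldType) (H : submonoid) (om : set 'X_{1..2}).
Variables (a : bool -> 'X_{1..2}) (b : 'X_{1..2}).
Variables (l : bool -> 'X_{1..2} -> int).
Hypothesis D : two_facets H om a b l.
Local Notation S := (strips om b l).
Local Notation R := (sring K H).
Local Notation inH := (submonoid_set H).
Local Notation m := (@sring_max K H).
Local Notation strip_gen := (strip_gen om a b l).
Local Notation gens := (gens om a b l).
Local Notation face_ideal := (@face_ideal K H l).
Local Notation face_poly := (@face_poly K H a).
Implicit Types (r s : R) (h k u p : 'X_{1..2}) (i : bool).

Lemma sring_max_prime : prime_ideal m.
Proof.
split; first exact: span_submodule.
  by move=> /sring_maxP; rewrite sring_val1 mcoeff1 eqxx => /eqP; rewrite oner_eq0.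
move=> r s /sring_maxP; rewrite sring_valM (rmorphM (mcoeff 0%MM)) /= => /eqP.
by rewrite mulf_eq0 => /orP[] /eqP r0; [left|right]; apply/sring_maxP.
Qed.

Lemma face_ideal_max i : face_ideal i `<=` m.
Proof.
move=> r Pr; apply/sring_maxP/memN_msupp_eq0/negP => /Pr.
by rewrite (facet0 D) eqxx.
Qed.

Lemma smon_ray_face_ideal i : ~ face_ideal i (smon (a i)).
Proof.
move=> /(_ (a i)); rewrite sring_val_smon; last exact: (ray_mem D).
by rewrite msuppX inE eqxx (facet_ray D) => /(_ isT).
Qed.

(** Modulo the face ideal [r] is a polynomial in [x^(a i)], without constant term as [r] is in
    [m]. *)
Lemma sring_max_face i r : m r ->
  exists f s, face_ideal i s /\ r = smon (a i) * f + s.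
Proof.
move=> /sring_maxP r0; have [f rf] := face_poly_surj D i r.
have f0 : root f 0.
  have f0E := coef_face_poly D i f 0.
  rewrite /root horner_coef0 -f0E mulm0n; apply/eqP.
  have : (sring_val (r - face_poly i f))@_0%MM = 0.
    by apply/sring_maxP; exact: face_ideal_max rf.
  by rewrite sring_valB mcoeffB r0 add0r => /eqP; rewrite oppr_eq0 => /eqP.
have /factor_theorem[g gE] := f0; rewrite polyC0 subr0 in gE.
exists (face_poly i g), (r - face_poly i f); split=> //.
by rewrite gE (face_polyM D) (face_polyX D); ring.
Qed.

(** The quotient by the face ideal is [K[X]]. Let [p] be a nonzero polynomial of least size with
    image in [Q], [g] one from [T] outside [Q], [d] their gcd and [p = c d]. Primeness puts the
    image of [c] or [d] into [Q]; [d] would bring [g] along, so it is [c], and minimality makes [d]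
    constant. Bezout then puts a unit into [T]. *)
Lemma face_ideal_chain i (P Q T : set R) : face_ideal i `<=` P ->
  prime_ideal Q -> prime_ideal T -> P `<` Q -> Q `<` T -> False.
Proof.
move=> iP primeQ primeT [PQ /existsNP[r /not_implyP[Qr nPr]]].
move=> [QT /existsNP[s /not_implyP[Ts nQs]]].
have liftr (I : set R) x y : ideal I -> face_ideal i `<=` I ->
    face_ideal i (x - y) -> I x <-> I y.
  move=> idI iI /iI xy; split=> Ixy.
    by rewrite -[y](subKr x); apply: (submoduleB (E := R^o) idI).
  by rewrite -[x](subrK y); apply: (submoduleD (E := R^o) idI).
have [[idQ Q1 QM] [idT T1 TM]] := (primeQ, primeT).
have iQ := subset_trans iP PQ; have iT := subset_trans iQ QT.
have [f rf] := face_poly_surj D i r; have [g sg] := face_poly_surj D i s.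
have Qf := proj1 (liftr Q r _ idQ iQ rf) Qr.
have Tg := proj1 (liftr T s _ idT iT sg) Ts.
have nQg : ~ Q (face_poly i g) by move=> /(proj2 (liftr Q s _ idQ iQ sg)).
have fN0 : f != 0.
  apply/eqP => f0; apply/nPr/iP.
  by move: rf; rewrite f0 -(polyC0 K) (face_polyC D) sconst0 subr0.
pose mem_size n := `[< exists p : {poly K}, [/\ p != 0, Q (face_poly i p) & size p = n] >].
have ex_size : exists n, mem_size n by exists (size f); apply/asboolP; exists f.
case: (ex_minnP ex_size) => n /asboolP[p [p0 Qp pn]] pmin {f rf Qf fN0 ex_size}.
case: n / pn in pmin.
have /dvdpP[c pE] := dvdp_gcdl p g; have /dvdpP[e gE] := dvdp_gcdr p g.
set d := gcdp p g in pE gE.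
have d0 : d != 0 by rewrite gcdp_eq0 (negbTE p0).
have c0 : c != 0 by apply: contraNneq p0 => c0; rewrite pE c0 mul0r.
have : Q (face_poly i c * face_poly i d) by rewrite -(face_polyM D) -pE.
case/QM => [Qc|Qd]; last first.
  by apply: nQg; rewrite gE (face_polyM D); apply: prime_idealMl.
have /size_poly1P[z z0 dE] : size d == 1%N.
  have pc : (size p <= size c)%N by apply: pmin; apply/asboolP; exists c.
  move: pc; rewrite {1}pE size_mul // -subn1 leq_subLR addnC leq_add2r.
  by rewrite leq_eqVlt ltnS leqn0 size_poly_eq0 (negbTE d0) orbF.
have [[u v] /= uvd] := Bezoutp p g.
have : size (u * p + v * g) == 1%N by rewrite (eqp_size uvd) -/d dE size_polyC z0.
case/size_poly1P => y y0 yE.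
apply: T1; rewrite (_ : 1 = sconst y^-1 * face_poly i (u * p + v * g)); last first.
  apply: sring_val_inj; rewrite yE (face_polyC D) sring_valM !sring_val_sconst.
  by rewrite sring_val1 -mpolyCM mulVf.
apply: prime_idealMl => //; rewrite (face_polyD D) !(face_polyM D).
apply: (submoduleD (E := R^o) idT); apply: prime_idealMl => //.
exact: QT.
Qed.

Variables (E : lmodType R) (coef : 'X_{1..2} -> E -> K) (mon : 'X_{1..2} -> E).
Hypothesis B : monomial_basis S coef mon.

(** An exponent [k] with [l i k = 0] keeps [k + p] in the strip, so the coefficient of [r] at [k]
    survives in [r *: mon p]. *)
Lemma annihilator_face_ideal i p : strip_gen i p ->
  annihilator E `<=` face_ideal i.
Proof.
move=> pG r rE k kr; apply/negP => /eqP lk.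
have Spk : S (k + p)%MM.
  by exists i; apply: (strip_face D (sring_msupp kr) lk); case: pG.
have := congr1 (coef (k + p)%MM) (rE (mon p)).
rewrite (coef_mulmon B) //; last exact: gen_strips pG.
rewrite lem_addl addmK (basis_coef0 B) => /eqP.
by rewrite -[_ == _]negbK -mcoeff_msupp kr.
Qed.

Lemma smon_int_annihilator h : om h ->
  annihilator E (smon h ^+ (`|l true b| + `|l false b|)).
Proof.
move=> oh x; have Hh := int_mem D oh; rewrite -smonX //.
apply: (basis_coef_eq0 B) => u; apply: contrapT => /eqP cu.
have Su := coef_supp B cu.
have [v uE /(coef_supp B) Sv] := coef_smon_neq0 B (submonoidMn _ Hh) cu.
rewrite uE in Su.
exact: (int_power_not_strips D oh (strips_int Sv) Su).
Qed.

(** Interior monomials have a power in the annihilator, so [P] contains them. As [a true + a false]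
    is interior, [P] contains the monomial of one ray; every exponent with [l i] nonzero is interior
    or a multiple of that ray. *)
Lemma prime_sup_annihilator (P : set R) : prime_ideal P -> annihilator E `<=` P ->
  exists i, face_ideal i `<=` P.
Proof.
move=> primeP annP; have [idP P1 PM] := primeP.
have Pom h : om h -> P (smon h).
  by move=> /smon_int_annihilator/annP; exact: prime_idealX.
have oa : om (a true + a false)%MM.
  apply/(facet_int D) => i; rewrite (facetD D).
  have := facet_rayN D i; case: i; rewrite /= ?(facet_ray D); lia.
have [i Pa] : exists i, P (smon (a (~~ i))).
  have := Pom _ oa; rewrite smonD; [|exact: (ray_mem D)..].
  by case/PM; [exists false|exists true].
exists i => r Pr; rewrite [r]sring_expand.
apply: (submodule_sum (E := R^o)) => // k kr; apply: prime_idealMl => //.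
have Hk := sring_msupp kr; have lk := Pr k kr.
have [lk'|lk'] := eqVneq (l (~~ i) k) 0.
  have [[|n] kE] := facet_face D Hk lk'; first by move: lk; rewrite kE mulm0n (facet0 D).
  rewrite kE mulmSr smonD; [|exact: (rayMn_mem D)|exact: (ray_mem D)].
  exact: prime_idealMl.
apply: Pom; apply/(facet_int D) => j; rewrite lt_neqAle eq_sym (facet_ge0 D) // andbT.
by have [->//|/neq_negb ->] := eqVneq j i.
Qed.

Lemma krull_dim_strips : (0 < size gens)%N -> krull_dim E 1.
Proof.
move=> g0; have [i [p pG]] : exists i p, strip_gen i p.
  have /(gensP D)[i pG] : nth 0%MM gens 0 \in gens by exact: mem_nth.
  by exists i, (nth 0%MM gens 0).
have annP := annihilator_face_ideal pG.
split.
  exists (fun n => if n is 0%N then face_ideal i else m); split.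
    move=> [|n] _; first by split=> //; exact: (face_ideal_prime D).
    by split; [exact: sring_max_prime|exact: subset_trans annP (@face_ideal_max i)].
  move=> [|//] _; split; first exact: face_ideal_max.
  move=> /(_ (smon (a i))) sub; apply: (@smon_ray_face_ideal i); apply: sub.
  by apply: smon_max; [exact: (ray_mem D)|exact: (ray_neq0 D)].
move=> G n [GQ Glt]; rewrite leqNgt; apply/negP => n2.
have [primeP annG] := GQ 0%N (leq0n n).
have [j jP] := prime_sup_annihilator primeP annG.
apply: (face_ideal_chain jP _ _ (Glt 0%N _) (Glt 1%N _)) => //.
- by have [] := GQ 1%N (ltnW n2).
- by have [] := GQ 2%N n2.
- exact: ltnW.
Qed.

(** On strip [i] one summand is an injective shift by [a i] and the other vanishes, which gives
    injectivity. The image is proper because no generator is a shift by a ray. *)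
Lemma regular_seq_rays : (0 < size gens)%N ->
  regular_seq E [:: smon (a true) + smon (a false)].
Proof.
move=> g0; split.
  move=> [|//] _ x; rewrite /= !smul0 /= => tx.
  apply: (basis_coef_eq0 B) => u; apply: contrapT => /eqP cu.
  have [i iu] := coef_supp B cu.
  have iau : strip om b l i (a i + u)%MM.
    by apply: (strip_face D) => //; [exact: (ray_mem D)|exact: (facet_ray D)].
  have /eqP c0 : coef (a i + u)%MM (smon (a (~~ i)) *: x) == 0.
    apply: contrapT => /negP/(coef_smon_neq0 B (ray_mem D _))[v uE /(coef_supp B) Sv].
    rewrite uE in iau; have := strip_shift D iau (strips_int Sv).
    by case: (i).
  have : coef (a i + u)%MM ((smon (a i) + smon (a (~~ i))) *: x) = 0.
    by case: (i); rewrite /= ?[smon (a false) + _]addrC tx (basis_coef0 B).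
  rewrite scalerDl (basis_coefD B) c0 addr0 (coef_smonD B); last first.
  - by exists i.
  - exact: (ray_mem D).
  by move=> cu0; rewrite cu0 eqxx in cu.
have /(gensP D)[i pG] : nth 0%MM gens 0 \in gens by exact: mem_nth.
have Sp := gen_strips pG.
rewrite smul1 => /seteqP[_ /(_ (mon (nth 0%MM gens 0)) I)[y yE]].
have := congr1 (coef (nth 0%MM gens 0)) yE.
rewrite (basis_coef_mon B) // eqxx scalerDl (basis_coefD B).
have c0 j : coef (nth 0%MM gens 0) (smon (a j) *: y) = 0.
  apply: contrapT => /eqP/(coef_smon_neq0 B (ray_mem D _))[v pE /(coef_supp B) Sv].
  have ov := strips_int Sv; case: pG => ip; case; exists v => //.
  by rewrite pE in ip *; rewrite (strip_shift D ip ov) addmC.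
by rewrite !c0 addr0; apply/eqP/oner_neq0.
Qed.

(* If [s1], [s2] were regular, take a generator [p] killed by the face ideal and
   write [si = x^a fi + ri] with [ri] in the face ideal. Then
   [s2 f1 p = f2 s1 p], so [f1 p = s1 w]; the face ideal kills [w] since [s1] is
   injective, hence [s1 p = x^a f1 p = s1 x^a w] and [p = x^a w]. *)
Lemma regular_seq_size (s : seq R) : (0 < size gens)%N ->
  (forall r, r \in s -> m r) -> regular_seq E s -> (size s <= 1)%N.
Proof.
move=> g0; case: s => [|s1 [|s2 s]] //= sm [reg _].
have [i [p0 pG0]] : exists i p, strip_gen i p.
  have /(gensP D)[i pG] : nth 0%MM gens 0 \in gens by exact: mem_nth.
  by exists i, (nth 0%MM gens 0).
have [p pG ptop] := top_strip_gen D pG0; have Sp := gen_strips pG.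
have s1_inj (x : E) : s1 *: x = 0 -> x = 0.
  by have := reg 0%N isT x; rewrite /= !smul0.
have s2_inj (x y : E) : s2 *: x = s1 *: y -> exists z, x = s1 *: z.
  move=> xy; have := reg 1%N isT x; rewrite /= !smul1; apply.
  by exists y.
have face_mon r : face_ideal i r -> r *: mon p = 0.
  move=> Pr; apply: (basis_coef_eq0 B) => u; apply: contrapT => /eqP cu.
  have [k [v [kr uE cv]]] := coefZ_neq0 B cu.
  have vp : v = p.
    have [->//|pv] := eqVneq p v; move: cv.
    by rewrite (basis_coef_mon B) // (negbTE pv) eqxx.
  apply: (ptop k (sring_msupp kr)).
    by rewrite lt_neqAle eq_sym Pr //= (facet_ge0 D i (sring_msupp kr)).
  by rewrite -vp -uE; exact: (coef_supp B cu).
have [f1 [r1 [P1 s1E]]] := @sring_max_face i s1 (sm _ (mem_head _ _)).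
have [|f2 [r2 [P2 s2E]]] := @sring_max_face i s2 _.
  by apply: sm; rewrite !inE eqxx orbT.
have s1p : s1 *: mon p = (smon (a i) * f1) *: mon p.
  by rewrite s1E scalerDl (face_mon _ P1) addr0.
have s2p : s2 *: mon p = (smon (a i) * f2) *: mon p.
  by rewrite s2E scalerDl (face_mon _ P2) addr0.
have [w wE] : exists w, f1 *: mon p = s1 *: w.
  apply: (s2_inj _ (f2 *: mon p)).
  rewrite !scalerA [s2 * f1]mulrC [s1 * f2]mulrC -!scalerA s1p s2p !scalerA.
  by congr (_ *: _); ring.
have face_w r : face_ideal i r -> r *: w = 0.
  move=> Pr; apply: s1_inj; rewrite scalerA mulrC -scalerA -wE scalerA mulrC.
  by rewrite -scalerA face_mon // scaler0.
have pw : mon p = smon (a i) *: w.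
  apply/eqP; rewrite -subr_eq0; apply/eqP/s1_inj.
  by rewrite scalerBr s1p -scalerA wE scalerA scalerA mulrC subrr.
have := congr1 (coef p) pw; rewrite (basis_coef_mon B) // eqxx => /esym c1.
have : coef p (smon (a i) *: w) != 0 by rewrite c1 oner_neq0.
case/(coef_smon_neq0 B (ray_mem D _)) => v pE /(coef_supp B) Sv.
case: pG => _; case; exists v; first exact: strips_int Sv.
by rewrite {1}pE addmC.
Qed.

Lemma cohen_macaulay_strips : (0 < size gens)%N -> cohen_macaulay m E.
Proof.
move=> g0; exists 1%N; split; first exact: krull_dim_strips.
split; last by move=> s; exact: regular_seq_size.
exists [:: smon (a true) + smon (a false)]; split=> //; last exact: regular_seq_rays.
move=> r; rewrite inE => /eqP ->; have [m_ideal _ _] := sring_max_prime.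
by apply: (submoduleD (E := R^o) m_ideal); apply: smon_max;
  do ?exact: (ray_mem D); exact: (ray_neq0 D).
Qed.

End KrullDepth.

(** * Cones in the plane *)

Section Determinants.
Variable F : realType.
Implicit Types (u v h k : 'X_{1..2}) (x y : 'rV[F]_2).

Lemma ord2P (i : 'I_2) : i = ord0 \/ i = ord_max.
Proof. by case: i => [[|[|//]] ltn2]; [left|right]; apply: val_inj. Qed.

Lemma mnm2P h k : h ord0 = k ord0 -> h ord_max = k ord_max -> h = k.
Proof. by move=> hk0 hk1; apply/mnmP => i; case: (ord2P i) => ->. Qed.

Lemma row2P x y : x 0 ord0 = y 0 ord0 -> x 0 ord_max = y 0 ord_max -> x = y.
Proof. by move=> xy0 xy1; apply/rowP => i; case: (ord2P i) => ->. Qed.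

Definition det2 x y : F := x 0 ord0 * y 0 ord_max - x 0 ord_max * y 0 ord0.

Definition det2Z u v : int :=
  (u ord0)%:Z * (v ord_max)%:Z - (u ord_max)%:Z * (v ord0)%:Z.

Lemma toRE h i : toR F h 0 i = (h i)%:R.
Proof. by rewrite !mxE. Qed.

Lemma det2_toR u v : det2 (toR F u) (toR F v) = (det2Z u v)%:~R.
Proof. by rewrite /det2 /det2Z !toRE intrB !intrM. Qed.

Lemma toZ_inj : injective toZ.
Proof.
move=> h k /rowP hk; apply/mnmP => i.
by have := hk i; rewrite !mxE => -[].
Qed.

Lemma primitive_det2Z_eq0 u v : primitive u -> primitive v ->
  det2Z u v = 0 -> u = v.
Proof.
rewrite /primitive /det2Z => cu cv uv0.
have uv : (u ord0 * v ord_max = u ord_max * v ord0)%N by lia.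
apply: mnm2P; apply/eqP; rewrite eqn_dvd; apply/andP; split.
- by rewrite -(Gauss_dvdr _ cu) -uv dvdn_mulr.
- by rewrite -(Gauss_dvdl _ cv) uv dvdn_mull.
- by rewrite coprime_sym in cu; rewrite -(Gauss_dvdr _ cu) uv dvdn_mulr.
- by rewrite coprime_sym in cv; rewrite -(Gauss_dvdl _ cv) -uv dvdn_mull.
Qed.

Lemma primitive_det2Z_mul u h : primitive u -> det2Z u h = 0 ->
  exists n, h = (u *+ n)%MM.
Proof.
rewrite /primitive /det2Z => cu uh0.
have uh : (u ord0 * h ord_max = u ord_max * h ord0)%N by lia.
have [u0|u0] := posnP (u ord0).
  move: cu uh; rewrite u0 /coprime gcd0n => /eqP u1; rewrite u1 mul0n mul1n => h0.
  by exists (h ord_max); apply: mnm2P; rewrite mulmnE ?u0 ?u1 ?mul0n ?mul1n.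
have /dvdnP[n hE] : (u ord0 %| h ord0)%N.
  by rewrite -(Gauss_dvdr _ cu) -uh dvdn_mulr.
exists n; apply: mnm2P; rewrite mulmnE; first by rewrite hE mulnC.
by apply/eqP; rewrite -(eqn_pmul2l u0) uh hE; apply/eqP; lia.
Qed.

Lemma linear_form_gt0_nbhs (c d : F) x : 0 < c * x 0 ord0 + d * x 0 ord_max ->
  exists2 e, 0 < e & forall y, (forall i, `|y 0 i - x 0 i| < e) ->
    0 < c * y 0 ord0 + d * y 0 ord_max.
Proof.
set f := _ + _ => f0.
have n0 : 0 < 1 + `|c| + `|d| by have := normr_ge0 c; have := normr_ge0 d; lra.
(* Within distance [e] the form drops by at most [(|c| + |d|) e], which is less than [f]. *)
exists (f / (1 + `|c| + `|d|)); first by rewrite divr_gt0.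
move=> y yx; set e := f / _ in yx.
have e0 : 0 < e by rewrite divr_gt0.
have fE : f = e * (1 + `|c| + `|d|) by rewrite mulrAC -mulrA divff ?mulr1 // gt_eqF.
have bound (c' : F) i : - (`|c'| * e) <= c' * (y 0 i - x 0 i).
  apply: le_trans (_ : - `|c' * (y 0 i - x 0 i)| <= _); last first.
    by rewrite lerNl -normrN ler_norm.
  by rewrite lerN2 normrM ler_wpM2l // ltW.
have := bound c ord0; have := bound d ord_max.
have -> : c * y 0 ord0 + d * y 0 ord_max =
   f + c * (y 0 ord0 - x 0 ord0) + d * (y 0 ord_max - x 0 ord_max).
  by rewrite /f; ring.
by rewrite fE; lra.
Qed.

End Determinants.

Section Cone.
Variables (F : realType) (H : submonoid).
Local Notation C := (cone_of F H).
Implicit Types (a h k : 'X_{1..2}) (v : 'rV[F]_2).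

Lemma cone_ofZ (c : F) v : 0 <= c -> C v -> C (c *: v).
Proof.
move=> c0 [s [sP ->]]; exists [seq (c * p.1, p.2) | p <- s]; split.
  by move=> _ /mapP[q /sP[q0 qH] ->]; split; [exact: mulr_ge0|].
by rewrite big_map scaler_sumr; apply: eq_bigr => p _; rewrite scalerA.
Qed.

Lemma cone_of_ge0 v i : C v -> 0 <= v 0 i.
Proof.
move=> [s [sP ->]]; rewrite summxE big_seq; apply: sumr_ge0 => p /sP[p0 [h _ <-]].
by rewrite mxE mulr_ge0 // toRE ler0n.
Qed.

Lemma cone_of0 : C 0.
Proof. by exists [::]; rewrite big_nil. Qed.

(** The weights [1], [d], [- d] sum to 1, the last one being placed at the origin. *)
Lemma affine_hull_cone a v (d : F) :
  submonoid_set H a -> C v -> affine_hull C (v + d *: toR F a).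
Proof.
move=> Ha Cv; exists [:: (1, v); (d, toR F a); (- d, 0)]; split.
- move=> p; rewrite !inE => /or3P[] /eqP -> //=; first exact: cone_of_mem.
  exact: cone_of0.
- by rewrite !big_cons big_nil /=; ring.
- by rewrite !big_cons big_nil /= scale1r scaler0 !addr0.
Qed.

Section Facet.
Variables a a' : 'X_{1..2}.
Hypothesis a_ext : extremal_vector F H a.
Hypothesis a'_ext : extremal_vector F H a'.
Hypothesis aa' : a <> a'.

(** The factor [det2 a a'] makes the sign independent of the orientation of the two rays. *)
Local Notation facet v := (det2 (toR F a) (toR F a') * det2 (toR F a) v).
Local Notation facet' v := (det2 (toR F a') (toR F a) * det2 (toR F a') v).

Lemma extremal_det2_neq0 : det2 (toR F a) (toR F a') != 0.
Proof.
rewrite det2_toR intr_eq0; apply/eqP => D0; apply: aa'.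
by case: a_ext a'_ext => _ pa _ [_ pa' _]; exact: primitive_det2Z_eq0.
Qed.

(** Cramer's rule, multiplied by the squared determinant to avoid division. *)
Lemma facet_decomp v : det2 (toR F a) (toR F a') ^+ 2 *: v =
  facet' v *: toR F a + facet v *: toR F a'.
Proof. by apply: row2P; rewrite /det2 !mxE; ring. Qed.

(** If [facet v] were negative, moving its term to the other side would write a point of the ray of
    [a] as a sum of two cone elements, one of them a positive multiple of [a']. Extremality would
    then make [a] and [a'] proportional. *)
Lemma cone_facet_ge0 v : C v -> 0 <= facet v.
Proof.
move=> Cv; have D0 := extremal_det2_neq0; rewrite leNgt; apply/negP => lt_v.
have [Ha _ [Ca a0 a_face]] := a_ext; have [Ha' _ [_ a'0 _]] := a'_ext.
have D2 : 0 < det2 (toR F a) (toR F a') ^+ 2 by rewrite exprn_even_gt0.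
have vi i : 0 <= facet' v * toR F a 0 i + facet v * toR F a' 0 i.
  have /rowP/(_ i) := facet_decomp v; rewrite !mxE => <-.
  by apply: mulr_ge0; [exact: ltW|exact: cone_of_ge0].
(* Otherwise both coefficients would be nonpositive, whereas [v] has nonnegative coordinates; this
   would force [a' = 0]. *)
have facet'v : 0 < facet' v.
  rewrite ltNge; apply/negP => le_v; apply: a'0; apply/rowP => i.
  have := vi i; have : 0 <= toR F a 0 i by rewrite toRE ler0n.
  have : 0 <= toR F a' 0 i by rewrite toRE ler0n.
  by rewrite [RHS]mxE; nra.
have [|||_ [r [r0 rE]]] := a_face (det2 (toR F a) (toR F a') ^+ 2 *: v)
    (- facet v *: toR F a') _ _ _.
- by apply: cone_ofZ => //; exact: ltW.
- by apply: cone_ofZ; [rewrite oppr_ge0 ltW|exact: cone_of_mem].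
- exists (facet' v); split; first exact: ltW.
  by rewrite facet_decomp scaleNr addrK.
have : det2 (toR F a) (- facet v *: toR F a') = 0.
  by rewrite rE /det2 !mxE; ring.
have -> : det2 (toR F a) (- facet v *: toR F a') =
    - facet v * det2 (toR F a) (toR F a') by rewrite /det2 !mxE; ring.
by move/eqP; rewrite mulf_eq0 (negbTE D0) orbF oppr_eq0 lt_eqF.
Qed.

Lemma facets_cone v : 0 <= facet v -> 0 <= facet' v -> C v.
Proof.
move=> fv f'v; have D0 := extremal_det2_neq0.
have D2 : 0 < det2 (toR F a) (toR F a') ^+ 2 by rewrite exprn_even_gt0.
rewrite -[v](scalerK (lt0r_neq0 D2)) facet_decomp.
apply: cone_ofZ; first by rewrite invr_ge0 ltW.
have [Ha _ _] := a_ext; have [Ha' _ _] := a'_ext.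
by apply: cone_ofD; apply: cone_ofZ => //; exact: cone_of_mem.
Qed.

(** From a point with [facet = 0], a small step along [- a'] makes the form negative, so leaves the
    cone. *)
Lemma omega_facet_gt0 h : omega F H h -> 0 < facet (toR F h).
Proof.
move=> [Ch [e [e0 nbhsP]]]; rewrite lt_neqAle cone_facet_ge0 // andbT eq_sym.
apply/eqP => fh0; have D0 := extremal_det2_neq0.
have D2 : 0 < det2 (toR F a) (toR F a') ^+ 2 by rewrite exprn_even_gt0.
have [Ha' _ _] := a'_ext.
(* Chosen larger than every coordinate of [a'], so that the step [e / n] along [a'] moves each
   coordinate by less than [e]. *)
pose n : F := 1 + (a' ord0)%:R + (a' ord_max)%:R.
have n0 : 0 < n by rewrite /n -addrA ltr_wpDr // addr_ge0.
have d0 : 0 < e / n by rewrite divr_gt0.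
have /cone_facet_ge0 : C (toR F h + (- (e / n)) *: toR F a').
  apply: nbhsP; first exact: affine_hull_cone.
  move=> i; rewrite mxE addrAC subrr add0r mxE toRE mulNr normrN ger0_norm; last first.
    by rewrite mulr_ge0 // ltW.
  rewrite -mulrA gtr_pMr // -ltr_pdivlMl ?invr_gt0 // invrK mulr1.
  have := ler0n F (a' ord0); have := ler0n F (a' ord_max).
  by rewrite /n; case: (ord2P i) => ->; lra.
suff -> : facet (toR F h + (- (e / n)) *: toR F a') =
    facet (toR F h) - e / n * det2 (toR F a) (toR F a') ^+ 2.
  by rewrite fh0; nra.
by rewrite /det2 !mxE; ring.
Qed.

Lemma facets_gt0_omega h : 0 < facet (toR F h) -> 0 < facet' (toR F h) ->
  omega F H h.
Proof.
move=> fh f'h; split; first by apply: facets_cone; exact: ltW.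
have linear (a1 a2 : 'X_{1..2}) (v : 'rV[F]_2) :
    det2 (toR F a1) (toR F a2) * det2 (toR F a1) v =
    (- det2 (toR F a1) (toR F a2) * toR F a1 0 ord_max) * v 0 ord0 +
    (det2 (toR F a1) (toR F a2) * toR F a1 0 ord0) * v 0 ord_max.
  by rewrite {2}/det2; ring.
rewrite linear in fh; rewrite linear in f'h.
have [e e0 eP] := linear_form_gt0_nbhs fh.
have [e' e'0 e'P] := linear_form_gt0_nbhs f'h.
exists (Num.min e e'); split; first by rewrite lt_min e0.
move=> y _ yh; apply: facets_cone; apply: ltW; rewrite linear.
  by apply: eP => i; apply: lt_le_trans (yh i) _; rewrite ge_min lexx.
by apply: e'P => i; apply: lt_le_trans (yh i) _; rewrite ge_min lexx orbT.
Qed.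

End Facet.
End Cone.

(** * The main theorem *)

Section TwoRays.
Variables (F : realType) (H : submonoid) (a : bool -> 'X_{1..2}) (b : 'X_{1..2}).
Hypothesis H_normal : normal F H.
Hypothesis a_ext : forall i, extremal_vector F H (a i).
Hypothesis a_neq : a true <> a false.
Hypothesis b_bot : bottom F H b.
Implicit Types (h k p : 'X_{1..2}) (i : bool).

Definition facet_form i h : int := det2Z (a i) (a (~~ i)) * det2Z (a i) h.
Local Notation l := facet_form.

Let a_neqN i : a i <> a (~~ i).
Proof. by case: i => //= /esym. Qed.

Lemma facet_form_toR i h : (l i h)%:~R =
  det2 (toR F (a i)) (toR F (a (~~ i))) * det2 (toR F (a i)) (toR F h).
Proof. by rewrite /facet_form intrM !det2_toR. Qed.

Let cone_facets (v : 'rV[F]_2) :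
  (forall i, 0 <= det2 (toR F (a i)) (toR F (a (~~ i))) * det2 (toR F (a i)) v) ->
  cone_of F H v.
Proof.
move=> vP; apply: (facets_cone (a_ext true) (a_ext false) a_neq).
  exact: vP true.
exact: vP false.
Qed.

Lemma two_facets_form : two_facets H (omega F H) a b l.
Proof.
have lD i h k : l i (h + k)%MM = l i h + l i k.
  by rewrite /facet_form /det2Z !mnmDE !PoszD; ring.
have l_mem h : submonoid_set H h <-> forall i, 0 <= l i h.
  split=> [Hh i|lh].
    rewrite -(ler0z F) facet_form_toR.
    by apply: (cone_facet_ge0 (a_ext i) (a_ext (~~ i))) => //; exact: cone_of_mem.
  have : [set z | cone_of F H (ZtoR F z)] (toZ h).
    by apply: cone_facets => i; rewrite -/(toR F h) -facet_form_toR ler0z.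
  by rewrite -H_normal => -[k Hk /toZ_inj <-].
split=> //.
(* The difference is a lattice point of the cone; normality makes it an element of [H], hence with
   nonnegative coordinates. *)
- move=> h k lkh; have : [set z | cone_of F H (ZtoR F z)] (toZ h - toZ k).
    apply: cone_facets => i.
    rewrite (_ : _ * _ = (l i h - l i k)%:~R) ?ler0z ?subr_ge0 //.
    rewrite intrB !facet_form_toR /ZtoR map_mxB -/(toR F h) -/(toR F k).
    by rewrite /det2 !mxE; ring.
  rewrite -H_normal => -[u _ /rowP uE]; apply/mnm_lepP => i.
  by have := uE i; rewrite !mxE; lia.
- move=> h; split=> [oh i|lh].
    rewrite -(ltr0z F) facet_form_toR.
    exact: (omega_facet_gt0 (a_ext i) (a_ext (~~ i)) (@a_neqN i) oh).
  apply: (facets_gt0_omega (a_ext true) (a_ext false) a_neq).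
    by have := lh true; rewrite -(ltr0z F) facet_form_toR.
  by have := lh false; rewrite -(ltr0z F) facet_form_toR.
- by move=> i; rewrite /facet_form /det2Z; ring.
- move=> i; rewrite /facet_form -expr2 exprn_even_gt0 //=.
  rewrite -(intr_eq0 F) -det2_toR.
  exact: (extremal_det2_neq0 (a_ext i) (a_ext (~~ i)) (@a_neqN i)).
- move=> i h _ /eqP; rewrite mulf_eq0 -(intr_eq0 F) -det2_toR.
  rewrite (negbTE (extremal_det2_neq0 (a_ext i) (a_ext (~~ i)) (@a_neqN i))) /=.
  by move=> /eqP; apply: primitive_det2Z_mul; case: (a_ext i).
- by case: b_bot.
- by case: b_bot.
Qed.

(** The form [l i] reads off [r2], so that [0 < r2 < 1] expresses the strip, and the other form then
    gives [r1]. The bounds on [r1] correspond to the impossibility of splitting off [a i], using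
    that [b] lies below all interior points. *)
Lemma starP i h : star F (a i) b h <-> strip_gen (omega F H) a b l i h.
Proof.
have D := two_facets_form; have bo := facet_bot D.
(* A coordinate where [b] is positive turns componentwise bounds by [b] into strict inequalities. *)
have [x bx] : exists x, (0 < b x)%N.
  apply: contrapT => nb; have := facet_gt0 D true bo.
  suff -> : b = 0%MM by rewrite (facet0 D).
  apply/mnmP => x; rewrite mnm0E; apply/eqP; rewrite -leqn0 leqNgt.
  by apply/negP => bx; apply: nb; exists x.
have bxF : 0 < (b x)%:R :> F by rewrite ltr0n.
have lbF j : 0 < (l j b)%:~R :> F by rewrite ltr0z (facet_gt0 D j bo).
have laF : 0 < (l (~~ i) (a i))%:~R :> F.
  by have := facet_rayN D (~~ i); rewrite negbK ltr0z.
split=> [[r1 [r2 [/andP[r1_gt r1_lt] /andP[r2_gt r2_lt] hE]]]|[[oh hb] nh]].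
  have lE j : (l j h)%:~R = r1 * (l j (a i))%:~R + r2 * (l j b)%:~R :> F.
    by rewrite !facet_form_toR hE /det2 !mxE; ring.
  have lih : (l i h)%:~R = r2 * (l i b)%:~R :> F.
    by rewrite lE (facet_ray D) mulr0 add0r.
  split; first split.
  - apply/(facet_int D) => j; rewrite -(ltr0z F).
    have [->|ji] := eqVneq j i; first by rewrite lih mulr_gt0.
    rewrite (neq_negb ji).
    by rewrite lE addr_gt0 // mulr_gt0.
  - by rewrite -(ltr_int F) lih gtr_pMl.
  (* From [u >= b], coordinate [x] of [h = u + a i] is at least that of [a i + b], more than that of
     [r1 a i + r2 b]. *)
  case=> u /(facet_bot_le D)/mnm_lepP/(_ x) bu hu.
  have := congr1 (fun z : 'rV[F]_2 => z 0 x) hE; rewrite hu !mxE mnmDE PoszD intrD.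
  have : (b x)%:R <= (u x)%:R :> F by rewrite ler_nat.
  have : 0 <= (a i x)%:R :> F by rewrite ler0n.
  rewrite -!pmulrn; nra.
pose r2 : F := (l i h)%:~R / (l i b)%:~R.
pose r1 : F := ((l (~~ i) h)%:~R - r2 * (l (~~ i) b)%:~R) / (l (~~ i) (a i))%:~R.
have r2E : (l i h)%:~R = r2 * (l i b)%:~R by rewrite divfK // gt_eqF.
have r1E : (l (~~ i) h)%:~R = r1 * (l (~~ i) (a i))%:~R + r2 * (l (~~ i) b)%:~R.
  by rewrite divfK ?subrK // gt_eqF.
have r2_gt : 0 < r2 by rewrite divr_gt0 // ltr0z (facet_gt0 D).
have r2_lt : r2 < 1 by rewrite ltr_pdivrMr // mul1r ltr_int.
have hE : toR F h = r1 *: toR F (a i) + r2 *: toR F b.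
  have D0 := extremal_det2_neq0 (a_ext i) (a_ext (~~ i)) (@a_neqN i).
  have D2 := expf_neq0 2 D0.
  apply: (scalerI D2); rewrite facet_decomp scalerDr !scalerA.
  rewrite [_ * r2]mulrC -[(r2 * _) *: toR F b]scalerA facet_decomp.
  move: r2E r1E; rewrite !facet_form_toR negbK => -> ->.
  by apply: row2P; rewrite /det2 !mxE; ring.
exists r1, r2; split=> //; last by rewrite r2_gt.
apply/andP; split.
  (* If [r1 <= 0], coordinate [x] of [h] is at most that of [r2 b], less than that of [b], although
     [b <= h]. *)
  rewrite ltNge; apply/negP => r1_le.
  have /mnm_lepP/(_ x) := facet_bot_le D oh; rewrite -(ler_nat F).
  have := congr1 (fun z : 'rV[F]_2 => z 0 x) hE; rewrite !mxE -!pmulrn.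
  have : 0 <= (a i x)%:R :> F by rewrite ler0n.
  nra.
(* If [r1 >= 1], both forms are positive on [h - a i], which is thus interior. *)
rewrite ltNge; apply/negP => r1_ge; apply: nh; apply: (int_diff D) => j.
have [->|ji] := eqVneq j i; first by rewrite (facet_ray D) (facet_gt0 D).
rewrite (neq_negb ji).
rewrite -(ltr_int F) r1E; have := lbF (~~ i); nra.
Qed.

End TwoRays.

Theorem lemma5p12 (F : realType) (K : fieldType) (H : submonoid)
    (a1 a2 b : 'X_{1..2})
    (H_N2 : normal_affine F H)
    (a1_ext : extremal_vector F H a1) (a2_ext : extremal_vector F H a2)
    (a12 : a1 <> a2)
    (b_bottom : bottom F H b) :
  ulrich_element K H F b <->
  (forall a, a = a1 \/ a = a2 ->
     forall p q, star F a b p -> star F a b q -> ~ star F a b (p + q)%MM).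
Proof.
pose a i := if i then a1 else a2.
have a_ext i : extremal_vector F H (a i) by case: i.
have H_normal : normal F H by case: H_N2.
have D := two_facets_form H_normal a_ext a12 b_bottom.
have sP := starP H_normal a_ext a12 b_bottom.
have B := quot_mon_basis K D.
have aP c : c = a1 \/ c = a2 <-> exists i, c = a i.
  by split=> [[->|->]|[[] ->]]; [exists true|exists false|left|right].
split=> [[_ U] c /aP[i ->] p q /sP pG /sP qG /sP|sum_gen].
  exact: (ulrich_sum_gen D B U pG qG).
split; first by case: b_bottom.
have {}sum_gen i p q : strip_gen (omega F H) a b (facet_form a) i p ->
    strip_gen (omega F H) a b (facet_form a) i q ->
    ~ strip_gen (omega F H) a b (facet_form a) i (p + q)%MM.
  move=> /sP pG /sP qG /sP; apply: sum_gen pG qG.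
  by apply/aP; exists i.
(* Without generators the strips are empty and [omega_R = x^b R]; the zero module is Ulrich by
   convention. *)
have [g0|g0] := posnP (size (gens (omega F H) a b (facet_form a))).
  by left; apply: (gens_nil D B); exact: size0nil.
right; split; first exact: (cohen_macaulay_strips D B g0).
exists (size (gens (omega F H) a b (facet_form a))); split.
  exact: (min_generators_gens D B sum_gen).
exact: (multiplicity_sum_free D B sum_gen g0 (krull_dim_strips D B g0)).
Qed.
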